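(* Let $\ket\Psi$ be an initial state of a local lattice Hamiltonian $H$ on $N$ sites (setting in the context) satisfying assumptions (LE) and (SR), and suppose $F(\tau)=F(0)$ for some $\tau>0$. Then for every eigenstate $\ket{E_i}$ with $c_i\ne0$ in the decomposition $\ket\Psi=\sum_jc_j\ket{E_j}$, and for every region $A\subseteq\Lambda$ that is sufficiently regular, meaning that the bipartition $A\cup\bar A$ is $m$-regular with the integer $m=\sqrt{hN\tau/(\pi|\partial A|)}$, the Rényi-$0$ entanglement entropy of $\rho_A=\mathrm{Tr}_{\bar A}[\ket{E_i}\bra{E_i}]$ is bounded as $$S_0(\rho_A)\le 7\sqrt{hN\tau|\partial A|}\,\log\!\big(hN^2\tau d^b\big)+|\partial A|\log\chi .$$
   Context: Setting. $\Lambda$ is a regular $D$-dimensional lattice of $N$ sites, each carrying a $d$-dimensional Hilbert space. $H=\sum_{x\in\Lambda}h_x$ is a local Hamiltonian: each $h_x$ is supported on at most $b$ neighbouring sites and $\|h_x\|\le h$. The ground state energy is normalized to $E_0=0$, so all energies lie in $[0,hN]$. $\hbar=1$; log is the natural logarithm. Assumption (LE), low entanglement. For every region $A\subseteq\Lambda$, the reduced density matrix of $\ket\Psi$ on $A$ has rank at most $\chi^{|\partial A|}$, where $|\partial A|$ is the area of the boundary of $A$ (for concreteness, the number of nearest-neighbour edges between $A$ and its complement $\bar A=\Lambda\setminus A$) and $\chi\ge1$ is independent of $N$. Assumption (SR). The pure state $\ket\Psi$ has exponentially decaying correlations with finite correlation length (there are constants $C,\xi>0$ independent of $N$ with $|\langle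 AB\rangle-\langle A\rangle\langle B\rangle|\le C\|A\|\|B\|e^{-\mathrm{dist}(A,B)/\xi}$ for observables $A,B$ supported on regions at distance $\mathrm{dist}(A,B)$), and $\sqrt{\langle H^2\rangle-\langle H\rangle^2}=s\sqrt N$ for a constant $s>0$ independent of $N$. Notation. $\ket\Psi=\sum_j c_j\ket{E_j}$ with $\ket{E_j}$ normalized energy eigenstates; in degenerate eigenspaces the basis is chosen so that each energy appears only once. $F(t)=|\bra\Psi e^{-itH}\ket\Psi|$. $S_0(\rho)=\log\mathrm{rank}(\rho)$. Regularity. The boundary $\mathcal B(A)$ of a set $A$ is the set of local terms $h_x$ supported on both $A$ and $\bar A$. For an integer $m\ge1$, the bipartition $A\cup\bar A$ is $m$-regular if: (1) there exist $2m$ non-empty sets $A_{-m},\dots,A_{-1},A_1,\dots,A_m$ with $A\subset A_1\subset A_2\subset\dots\subset A_m$ and $A\supset A_{-1}\supset A_{-2}\supset\dots\supset A_{-m}$ (put $A_0=A$); (2) the numbers of sites in $A_m\setminus A$ and in $A\setminus A_{-m}$ are each at most $10m|\partial A|$; (3) every local term $h_x$ belongs to at most one $\mathcal B(A_q)$, $q\in\{-m,\dots,m\}$. *)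

(* Defs.v *)
(* MathComp / MathComp-Analysis; complex numbers are R[i] for R : realType. *)
From HB Require Import structures.
From mathcomp Require Import all_boot all_order all_algebra.
From mathcomp Require Import all_classical all_reals all_analysis.
From mathcomp Require Import complex.

Set Implicit Arguments.
Unset Strict Implicit.
Unset Printing Implicit Defensive.

Import Order.TTheory GRing.Theory Num.Theory.
Import numFieldNormedType.Exports.

Local Open Scope ring_scope.
Local Open Scope complex_scope.
Local Open Scope sesquilinear_scope.

(* A finite block of a D-dimensional crystal: [extent k] unit cells in direction
   [k], each holding one copy of the motif [cell]; the boundary condition is
   periodic or open, direction by direction.  A bond (a, c, v) joins the copy of
   motif point [a] in cell z to the copy of [c] in cell z + v, for every z. *)
Record lattice (D : nat) := Lattice {
  cell : finType;
  extent : 'I_D -> nat;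
  periodic : pred 'I_D;
  bonds : seq (cell * cell * ('I_D -> int))
}.

Definition site D (L : lattice D) : finType :=
  (cell L * {dffun forall k : 'I_D, 'I_(extent L k)})%type.

Definition translated D (L : lattice D) (v : 'I_D -> int) (x y : site L) : bool :=
  [forall k : 'I_D,
     let xk := (x.2 k : nat)%:Z in let yk := (y.2 k : nat)%:Z in
     if periodic L k then (yk == xk + v k %[mod (extent L k)%:Z])%Z
     else yk == xk + v k].

Definition bonded D (L : lattice D) (x y : site L) : bool :=
  has (fun e : cell L * cell L * ('I_D -> int) =>
         [&& x.1 == e.1.1, y.1 == e.1.2 & translated e.2 x y]) (bonds L).

Definition neighbour D (L : lattice D) : rel (site L) :=
  [rel x y | (x != y) && (bonded x y || bonded y x)].

Definition lattice_connected D (L : lattice D) : Prop :=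
  forall x y : site L, connect (@neighbour D L) x y.

Section Geometry.
Variables (T : finType) (nn : rel T).
Implicit Types (A X Y S : {set T}).

(* Each edge between A and its complement is counted once, from its end in A. *)
Definition area A : nat :=
  #|[set e : T * T | [&& e.1 \in A, e.2 \notin A & nn e.1 e.2]]|.

(* Length of a shortest path from X to Y; #|T| if there is none (which, on a
   connected lattice, only happens when X or Y is empty). *)
Definition lattice_distance X Y : nat :=
  find (fun n => [exists x in X, exists p : n.-tuple T,
                    path nn x p && (last x p \in Y)])
       (iota 0 #|T|).

Definition connected_cluster S : Prop :=
  forall x y, x \in S -> y \in S ->
    connect [rel u v | [&& u \in S, v \in S & nn u v]] x y.

End Geometry.

Section Quantum.
Variables (R : realType) (T : finType) (d : nat).

Definition config : finType := {ffun T -> 'I_d}.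

(* Vectors and operators on the tensor product of #|T| copies of C^d, written
   in the product basis, whose labels are the configurations. *)
Definition state := 'cV[R[i]]_#|config|.
Definition operator := 'M[R[i]]_#|config|.

Definition config_on (X : {set T}) : finType := {ffun {x | x \in X} -> 'I_d}.

Definition restrict_config (X : {set T}) (f : config) : config_on X :=
  [ffun y => f (val y)].

(* A = M (x) 1, with M acting on the sites of X *)
Definition supported_on (X : {set T}) (A : operator) : Prop :=
  exists M : 'M[R[i]]_#|config_on X|, forall f g : config,
    A (enum_rank f) (enum_rank g) =
      M (enum_rank (restrict_config X f)) (enum_rank (restrict_config X g))
        *+ (restrict_config (~: X) f == restrict_config (~: X) g).

(* The sites on which A acts non-trivially *)
Definition op_support (A : operator) : {set T} :=
  [set y | ~~ `[< supported_on (~: [set y]) A >]].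

Definition inner (u v : state) : R[i] := (u ^t* *m v) 0 0.

Definition normalized (v : state) : Prop := inner v v = 1.

Definition vnorm (v : state) : R := Num.sqrt (complex.Re (inner v v)).

Definition opnorm (A : operator) : R :=
  sup [set vnorm (A *m v) | v in [set v : state | normalized v]].

Definition expect (v : state) (A : operator) : R[i] := inner v (A *m v).

Definition projector (v : state) : operator := v *m v ^t*.

(* Partial trace over the complement of A *)
Definition reduced (A : {set T}) (rho : operator) : 'M[R[i]]_#|config_on A| :=
  \matrix_(a, b) \sum_(f : config | restrict_config A f == enum_val a)
    \sum_(g : config | (restrict_config A g == enum_val b)
                       && (restrict_config (~: A) g == restrict_config (~: A) f))
      rho (enum_rank f) (enum_rank g).

Definition renyi0 n (rho : 'M[R[i]]_n) : R := ln (\rank rho)%:R.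

(* Entrywise limit of the exponential series; real and imaginary parts are
   taken separately. *)
Definition expmx (A : operator) : operator :=
  let S n : operator := \sum_(k < n) (k`!%:R)^-1 *: A ^+ k in
  \matrix_(i, j) (limn (fun n => complex.Re (S n i j))
                  +i* limn (fun n => complex.Im (S n i j))).

Definition fidelity (H : operator) (psi : state) (t : R) : R :=
  Normc.normc (expect psi (expmx ((0 -i* t) *: H))).

Definition ground_energy (H : operator) (E0 : R) : Prop :=
  eigenvalue H E0%:C /\ forall E : R, eigenvalue H E%:C -> E0 <= E.

Definition energy_eigenstate (H : operator) (E : R) (v : state) : Prop :=
  normalized v /\ H *m v = E%:C *: v.

End Quantum.

Section Assumptions.
Variables (R : realType) (T : finType) (nn : rel T) (d : nat).

Definition local_term (b : nat) (h : R) (A : operator R T d) : Prop :=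
  [/\ A \is hermsymmx,
      opnorm A <= h
    & exists S : {set T}, [/\ connected_cluster nn S, (#|S| <= b)%N & supported_on S A]].

Definition hamiltonian (hx : T -> operator R T d) : operator R T d :=
  \sum_x hx x.

Definition low_entanglement (chi : R) (psi : state R T d) : Prop :=
  forall A : {set T},
    (\rank (reduced A (projector psi)))%:R <= chi ^+ area nn A.

Definition decaying_correlations (C xi : R) (psi : state R T d) : Prop :=
  forall (X Y : {set T}) (A B : operator R T d),
    A \is hermsymmx -> B \is hermsymmx ->
    supported_on X A -> supported_on Y B ->
    Normc.normc (expect psi (A *m B) - expect psi A * expect psi B)
      <= C * opnorm A * opnorm B * expR (- ((lattice_distance nn X Y)%:R / xi)).

Definition energy_spread (H : operator R T d) (psi : state R T d) : R :=
  Num.sqrt (complex.Re (expect psi (H *m H) - expect psi H ^+ 2)).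

(* Labels x of the terms h_x acting on both sides of the cut *)
Definition boundary_terms (hx : T -> operator R T d) (A : {set T}) : {set T} :=
  [set x | (op_support (hx x) :&: A != finset.set0)
           && (op_support (hx x) :&: ~: A != finset.set0)].

Definition cut_regular (hx : T -> operator R T d) (m : nat) (A : {set T}) : Prop :=
  exists As : int -> {set T},
    [/\ As 0 = A,
        forall q : int, - m%:Z <= q <= m%:Z -> q != 0 -> As q != finset.set0,
        forall q : int, - m%:Z <= q < m%:Z -> As q \subset As (q + 1),
        (#|As m%:Z :\: A| <= 10 * m * area nn A)%N
          /\ (#|A :\: As (- m%:Z)| <= 10 * m * area nn A)%N
      & forall (x : T) (q r : int),
          - m%:Z <= q <= m%:Z -> - m%:Z <= r <= m%:Z ->
          x \in boundary_terms hx (As q) -> x \in boundary_terms hx (As r) ->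
          q = r].

End Assumptions.

(* Main.v *)
(* Perfect revival forces all phases exp (- i tau E_j) with c_j <> 0 to coincide,
   so the energies occurring in psi are spaced by at least 2 pi / tau.  As they
   lie in [0, h N], there are K + 1 of them with K <= h N tau / (2 pi), and
   Lagrange interpolation writes E_i as a polynomial of degree K in H applied
   to psi.

   H ^ k psi is a sum over words in the letters h_x.  The 2 m + 1 cuts A_q have
   disjoint boundaries, so a word of length at most K crosses some cut at most
   l = K %/ (2 m + 1) times; attach it to the first such cut.  Being attached to
   q constrains, besides the number of letters across A_q, only the letters on
   the left of A_q, because these include all the letters across earlier cuts.
   Given the number of letters across A_q and the lengths of the left and right
   words between them, the sum over words therefore factorises across A_q, which
   bounds the Schmidt rank there by roughly (K ^ 2 N d ^ (2 b)) ^ l.  Going from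
   A to A_q and back costs a factor d ^ (20 m a), a being the area of A. *)
From HB Require Import structures.
Require Import Defs.
From mathcomp Require Import all_boot all_order all_algebra.
From mathcomp Require Import all_classical all_reals all_analysis.
From mathcomp Require Import complex ring lra zify.

Set Implicit Arguments.
Unset Strict Implicit.
Unset Printing Implicit Defensive.

Import Order.TTheory GRing.Theory Num.Theory.
Import numFieldNormedType.Exports.

Local Open Scope complex_scope.
Local Open Scope ring_scope.
Local Open Scope sesquilinear_scope.

(** * Sums over words and their rank across a cut *)

Section WordSum.
Variables (F : fieldType) (T : finType) (V : lmodType F).
Variable act : T -> V -> V.
Hypothesis act_linear : forall x, linear (act x).

(** The head of a word acts last. Passing the weight as a function of the remaining letters makes
    splitting off the head a computation step. *)
Fixpoint wsum (v : V) (k : nat) (g : seq T -> F) : V :=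
  if k is k'.+1 then \sum_x act x (wsum v k' (fun w => g (x :: w)))
  else g [::] *: v.

Lemma wsum_ext v k g1 g2 :
  (forall w, size w = k -> g1 w = g2 w) -> wsum v k g1 = wsum v k g2.
Proof.
elim: k g1 g2 => [|k IHk] g1 g2 eq_g /=; first by rewrite eq_g.
apply: eq_bigr => x _; congr (act x _); apply: IHk => w sz_w.
by apply: eq_g; rewrite /= sz_w.
Qed.

Lemma actP x a u w : act x (a *: u + w) = a *: act x u + act x w.
Proof. exact: act_linear. Qed.

Lemma act0 x : act x 0 = 0.
Proof.
have := actP x 1 0 0; rewrite !scale1r addr0 => /eqP.
by rewrite -subr_eq subrr eq_sym => /eqP.
Qed.

Lemma actD x u w : act x (u + w) = act x u + act x w.
Proof. by have := actP x 1 u w; rewrite !scale1r. Qed.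

Lemma wsum0 v k : wsum v k (fun _ => 0) = 0.
Proof.
elim: k => [|k IHk] /=; first by rewrite scale0r.
by rewrite big1 // => x _; rewrite IHk act0.
Qed.

Lemma wsumD v k g1 g2 :
  wsum v k (fun w => g1 w + g2 w) = wsum v k g1 + wsum v k g2.
Proof.
elim: k g1 g2 => [|k IHk] g1 g2 /=; first by rewrite scalerDl.
by rewrite -big_split /=; apply: eq_bigr => x _; rewrite IHk actD.
Qed.

Lemma wsum_sum (I : Type) (r : seq I) v k (g : I -> seq T -> F) :
  wsum v k (fun w => \sum_(i <- r) g i w) = \sum_(i <- r) wsum v k (g i).
Proof.
elim: r => [|i r IHr].
  rewrite big_nil -[RHS](wsum0 v k); apply: wsum_ext => w _.
  by rewrite big_nil.
rewrite big_cons -IHr -wsumD; apply: wsum_ext => w _.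
by rewrite big_cons.
Qed.

Lemma iter_wsum v k :
  iter k (fun u => \sum_x act x u) v = wsum v k (fun _ => 1).
Proof. by elim: k => [|k IHk] /=; rewrite ?scale1r // IHk. Qed.

End WordSum.

(** Moves a sum over words from states to matrices, [f] being the passage to amplitudes across a
    cut. *)
Lemma wsum_morph (F : fieldType) (T : finType) (V W : lmodType F)
    (act : T -> V -> V) (act' : T -> W -> W) (f : {linear V -> W}) v k g :
  (forall x u, f (act x u) = act' x (f u)) ->
  f (wsum act v k g) = wsum act' (f v) k g.
Proof.
move=> fact; elim: k g => [|k IHk] g /=; first by rewrite linearZ.
by rewrite linear_sum; apply: eq_bigr => x _; rewrite fact IHk.
Qed.

Lemma size_index_enum (T : finType) : size (index_enum T) = #|T|.
Proof. by rewrite [index_enum T]unlock cardT enumT. Qed.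

(** * Rank of a sum over words with a given number of crossings *)

Section CutRank.
Variables (F : fieldType) (T : finType) (p q : nat) (M0 : 'M[F]_(p, q)).

Definition word_family := (seq T -> F) -> 'M[F]_(p, q).

(* The coefficients on the right of M0 do not depend on the weight om: this is
   what allows one to impose a condition on the left letters for free. *)
Definition family_rank_le (Phi : word_family) (r : nat) : Prop :=
  exists s : seq (((seq T -> F) -> 'M[F]_p) * 'M[F]_q), (size s <= r)%N /\
    forall om, Phi om = \sum_(t <- s) t.1 om *m M0 *m t.2.

Lemma family_rank_ext Phi Psi r :
  Phi =1 Psi -> family_rank_le Phi r -> family_rank_le Psi r.
Proof. by move=> eq_f [s [sz hs]]; exists s; split=> // om; rewrite -eq_f. Qed.

Lemma family_rank_widen Phi r r' :
  (r <= r')%N -> family_rank_le Phi r -> family_rank_le Phi r'.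
Proof. by move=> le_r [s [sz hs]]; exists s; split=> //; apply: leq_trans le_r. Qed.

Lemma family_rank_rank Phi r om :
  family_rank_le Phi r -> (\rank (Phi om) <= r * \rank M0)%N.
Proof.
case=> s [sz ->]; apply: leq_trans (leq_mul sz (leqnn _)).
elim: s {sz} => [|t s IHs]; first by rewrite big_nil mxrank0.
rewrite big_cons mulSn; apply: leq_trans (mxrank_add _ _) _.
apply: leq_add IHs; apply: leq_trans (mxrankM_maxl _ _) _.
exact: mxrankM_maxr.
Qed.

Lemma family_rank0 r : family_rank_le (fun _ => 0) r.
Proof. by exists [::]; split=> // om; rewrite big_nil. Qed.

Lemma family_rankD Phi Psi r r' :
  family_rank_le Phi r -> family_rank_le Psi r' ->
  family_rank_le (fun om => Phi om + Psi om) (r + r').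
Proof.
move=> [s [sz hs]] [s' [sz' hs']]; exists (s ++ s').
by rewrite size_cat leq_add //; split=> // om; rewrite big_cat hs hs'.
Qed.

Lemma family_rank_sum (I : Type) (l : seq I) (P : pred I) (Phi : I -> word_family) r :
  (forall i, P i -> family_rank_le (Phi i) r) ->
  family_rank_le (fun om => \sum_(i <- l | P i) Phi i om) (size l * r).
Proof.
move=> hPhi; elim: l => [|i l IHl].
  by apply: (family_rank_ext _ (family_rank0 _)) => om; rewrite big_nil.
case Pi: (P i).
  apply: (family_rank_ext _ (family_rankD (hPhi i Pi) IHl)) => om /=.
  by rewrite big_cons Pi.
apply: (family_rank_ext (Phi := fun om => \sum_(i <- l | P i) Phi i om)).
  by move=> om; rewrite big_cons Pi.
by apply: family_rank_widen IHl; rewrite mulSn leq_addl.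
Qed.

Lemma family_rankM Phi r (L : 'M[F]_p) (Q : 'M[F]_q) :
  family_rank_le Phi r -> family_rank_le (fun om => L *m Phi om *m Q) r.
Proof.
move=> [s [sz hs]].
exists [seq ((fun om => L *m t.1 om), t.2 *m Q) | t <- s].
rewrite size_map; split=> // om; rewrite hs big_map mulmx_sumr mulmx_suml.
by apply: eq_bigr => t _; rewrite !mulmxA.
Qed.

Variables (lt rt bd : pred T) (l : T -> 'M[F]_p) (r : T -> 'M[F]_q).

(** The weight reads the left letters only: [left_step] feeds it the new letter, [right_step] leaves
    it alone. *)
Definition left_step (Phi : word_family) : word_family :=
  fun om => \sum_(x | lt x) l x *m Phi (fun u => om (x :: u)).

Definition right_step (Phi : word_family) : word_family :=
  fun om => Phi om *m \sum_(x | rt x) r x.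

Definition both_step (Phi : word_family) : word_family :=
  fun om => left_step Phi om + right_step Phi om.

(** Left letters are absorbed by the left coefficients, which may depend on the weight, so the
    number of terms does not grow. Right letters are absorbed likewise by the right coefficients. *)
Lemma family_rank_left Phi k :
  family_rank_le Phi k -> family_rank_le (left_step Phi) k.
Proof.
move=> [s [sz hs]].
exists [seq ((fun om => \sum_(x | lt x) l x *m t.1 (fun u => om (x :: u))),
             t.2) | t <- s].
rewrite size_map; split=> // om; rewrite big_map /left_step.
under [LHS]eq_bigr => x _ do rewrite hs mulmx_sumr.
rewrite exchange_big; apply: eq_bigr => t _; rewrite !mulmx_suml.
by apply: eq_bigr => x _; rewrite !mulmxA.
Qed.

Lemma family_rank_right Phi k :
  family_rank_le Phi k -> family_rank_le (right_step Phi) k.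
Proof.
move/(family_rankM 1%:M (\sum_(x | rt x) r x)).
by apply: family_rank_ext => om; rewrite mul1mx.
Qed.

Lemma left_step_sum (n : nat) (c : 'I_n -> F) (Phi : 'I_n -> word_family) om :
  left_step (fun om => \sum_(i < n) c i *: Phi i om) om
    = \sum_(i < n) c i *: left_step (Phi i) om.
Proof.
rewrite /left_step; under [LHS]eq_bigr => x _ do rewrite mulmx_sumr.
rewrite exchange_big; apply: eq_bigr => i _; rewrite scaler_sumr.
by apply: eq_bigr => x _; rewrite scalemxAr.
Qed.

Lemma right_step_sum (n : nat) (c : 'I_n -> F) (Phi : 'I_n -> word_family) om :
  right_step (fun om => \sum_(i < n) c i *: Phi i om) om
    = \sum_(i < n) c i *: right_step (Phi i) om.
Proof.
by rewrite /right_step mulmx_suml; apply: eq_bigr => i _; rewrite scalemxAl.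
Qed.

Lemma left_step_ext Phi Psi : Phi =1 Psi -> left_step Phi =1 left_step Psi.
Proof. by move=> e om; apply: eq_bigr => x _; rewrite e. Qed.

Lemma right_left_step Phi :
  right_step (left_step Phi) =1 left_step (right_step Phi).
Proof.
move=> om; rewrite /right_step /left_step mulmx_suml.
by apply: eq_bigr => x _; rewrite mulmxA.
Qed.

Lemma right_iter_left_step Phi a :
  right_step (iter a left_step Phi) =1 iter a left_step (right_step Phi).
Proof.
elim: a => [|a IHa] om //=; rewrite right_left_step.
exact: left_step_ext.
Qed.

Lemma right_step_ext Phi Psi : Phi =1 Psi -> right_step Phi =1 right_step Psi.
Proof. by move=> e om; rewrite /right_step e. Qed.

(* Left and right letters act on different sides of M0, hence commute: k steps
   expand into k+1 terms instead of 2^k. *)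
Lemma iter_both_step Phi k :
  iter k both_step Phi =1 fun om => \sum_(a < k.+1) 'C(k, a)%:R *:
    iter a left_step (iter (k - a) right_step Phi) om.
Proof.
elim: k => [|k IHk] om; first by rewrite big_ord1 scale1r.
have -> : iter k.+1 both_step Phi om
  = left_step (iter k both_step Phi) om + right_step (iter k both_step Phi) om.
  by [].
rewrite (left_step_ext IHk) left_step_sum (right_step_ext IHk) right_step_sum.
under [X in _ + X]eq_bigr => a _.
  rewrite right_iter_left_step -[right_step (iter _ _ _)]/(iter (k - a).+1 _ _).
  rewrite -subSn; last by rewrite -ltnS.
  over.
(* Pascal's rule, after the extreme terms are set apart. *)
rewrite [X in _ + X]big_ord_recl [in RHS]big_ord_recl /= !bin0 addrCA.
congr (_ + _).
rewrite [in RHS]big_ord_recr /=.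
under [X in _ = X + _]eq_bigr => a _.
  rewrite /bump leq0n add1n binS natrD scalerDl subSS.
  over.
rewrite big_split /= [X in X + _ = _]big_ord_recr /= addrAC addrC.
rewrite addrC [X in X + _]addrC; congr (_ + _ + _); rewrite /bump leq0n add1n.
by rewrite binS (bin_small (ltnSn k)) add0n subSS.
Qed.

Lemma family_rankZ Phi n (c : F) :
  family_rank_le Phi n -> family_rank_le (fun om => c *: Phi om) n.
Proof.
move/(family_rankM c%:M 1%:M); apply: family_rank_ext => om.
by rewrite mulmx1 mul_scalar_mx.
Qed.

Lemma iter_both_step_rank Phi n k :
  family_rank_le Phi n -> family_rank_le (iter k both_step Phi) (k.+1 * n).
Proof.
move=> hPhi; apply: (family_rank_ext (fsym (iter_both_step Phi k))).
have := @family_rank_sum _ (index_enum 'I_k.+1) predT (fun a om =>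
  'C(k, a)%:R *: iter a left_step (iter (k - a) right_step Phi) om) n.
rewrite size_index_enum card_ord => hs; apply: hs => a _; apply: family_rankZ.
have: family_rank_le (iter (k - a) right_step Phi) n.
  by elim: (k - a)%N => [|b IHb] //=; apply: family_rank_right.
move: (iter _ _ _) => Psi hPsi.
by elim: (a : nat) => [|b IHb] //=; apply: family_rank_left.
Qed.

Lemma both_step_ext Phi Psi : Phi =1 Psi -> both_step Phi =1 both_step Psi.
Proof.
by move=> e om; rewrite /both_step (left_step_ext e) (right_step_ext e).
Qed.

Lemma both_step_sum n (Phi : 'I_n -> word_family) om :
  both_step (fun om => \sum_(i < n) Phi i om) om
    = \sum_(i < n) both_step (Phi i) om.
Proof.
have e : (fun om => \sum_(i < n) Phi i om) =1
         (fun om => \sum_(i < n) 1 *: Phi i om).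
  by move=> om'; apply: eq_bigr => i _; rewrite scale1r.
rewrite (both_step_ext e) /both_step left_step_sum right_step_sum -big_split.
by apply: eq_bigr => i _; rewrite !scale1r.
Qed.

Variables (act : T -> 'M[F]_(p, q) -> 'M[F]_(p, q)).
Variables (e : nat) (B : T -> seq ('M[F]_p * 'M[F]_q)).
Hypothesis act_linear : forall x, linear (act x).
Hypothesis kindP : forall x, (lt x + rt x + bd x = 1)%N.
Hypothesis act_left : forall x M, lt x -> act x M = l x *m M.
Hypothesis act_right : forall x M, rt x -> act x M = M *m r x.
Hypothesis act_bd : forall x M, bd x -> act x M = \sum_(t <- B x) t.1 *m M *m t.2.
Hypothesis size_B : forall x, (size (B x) <= e)%N.

Definition crossing (j k : nat) : word_family := fun om =>
  wsum act M0 k (fun w => (count bd w == j)%:R * om (seq.filter lt w)).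

Definition bd_step (Phi : word_family) : word_family :=
  fun om => \sum_(x | bd x) act x (Phi om).

(** By the kind of the head letter, which is exactly one of left, right and across. A letter across
    the cut uses up one of the [j] crossings, and for [j = 0] contributes nothing. *)
Lemma crossing_rec j k om :
  crossing j k.+1 om = both_step (crossing j k) om +
    bd_step (if j is j'.+1 then crossing j' k else fun _ => 0) om.
Proof.
rewrite /both_step /left_step /right_step /bd_step {1}/crossing /=.
rewrite (bigID lt) /= -addrA; congr (_ + _).
  apply: eq_bigr => x ltx; rewrite act_left //; congr (_ *m _).
  apply: wsum_ext => w _; rewrite ltx.
  by have := kindP x; rewrite ltx; case: (bd x) => //; rewrite addn1.
rewrite (bigID rt) /=; congr (_ + _).
  rewrite mulmx_sumr [LHS](eq_bigl rt) => [|x]; last first.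
    by have := kindP x; case: (lt x) (rt x) => -[].
  apply: eq_bigr => x rtx; rewrite act_right //; congr (_ *m _).
  apply: wsum_ext => w _; have := kindP x; rewrite rtx.
  by case: (lt x) (bd x) => -[] // _; rewrite add0n.
rewrite [LHS](eq_bigl bd) => [|x]; last first.
  by have := kindP x; case: (lt x) (rt x) (bd x) => -[] [].
apply: eq_bigr => x bdx; congr (act x _).
have ltx : lt x = false.
  by have := kindP x; rewrite bdx; case: (lt x) (rt x) => -[].
case: j => [|j].
  rewrite -[RHS](wsum0 act_linear M0 k); apply: wsum_ext => w _.
  by rewrite bdx mul0r.
by apply: wsum_ext => w _; rewrite bdx ltx add1n eqSS.
Qed.

Lemma crossing0 k :
  crossing 0 k =1 iter k both_step (fun om => om [::] *: M0).
Proof.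
elim: k => [|k IHk] om; first by rewrite /crossing /= mul1r.
rewrite crossing_rec iterS (both_step_ext IHk) /bd_step big1 ?addr0 // => x _.
exact: act0.
Qed.

(* Words are split at their first letter across the cut. *)
Lemma crossingS j k :
  crossing j.+1 k =1 fun om => \sum_(i < k)
    iter i both_step (bd_step (crossing j (k - i.+1))) om.
Proof.
elim: k => [|k IHk] om; first by rewrite big_ord0 /crossing /= mul0r scale0r.
rewrite crossing_rec (both_step_ext IHk) both_step_sum big_ord_recl addrC.
by rewrite subSS subn0; congr (_ + _); apply: eq_bigr.
Qed.

Lemma bd_step_rank Phi n :
  family_rank_le Phi n -> family_rank_le (bd_step Phi) (#|T| * (e * n)).
Proof.
move=> hPhi; have := @family_rank_sum _ (index_enum T) bd (fun x om => act x (Phi om)) (e * n).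
rewrite size_index_enum => hs; apply: hs => x bdx.
apply: (@family_rank_widen _ (size (B x) * n)); first by rewrite leq_mul.
apply: (family_rank_ext (Phi := fun om =>
    \sum_(t <- B x) t.1 *m Phi om *m t.2)) => [om|]; first by rewrite act_bd.
apply: (@family_rank_sum _ (B x) predT (fun t om => t.1 *m Phi om *m t.2)).
by move=> t _; apply: family_rankM.
Qed.

(** Each crossing costs [#|T| * e] for the letter, one factor [K.+1] for its position and one for
    the numbers of left and right letters between it and the previous crossing. The leading [K.+1]
    pays for the letters after the last crossing. *)
Lemma crossing_rank j k K : (k <= K)%N ->
  family_rank_le (crossing j k) (K.+1 * (K.+1 ^ 2 * (#|T| * e)) ^ j).
Proof.
elim: j k => [|j IHj] k le_kK.
  apply: (family_rank_ext (fsym (crossing0 k))); rewrite expn0 muln1.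
  apply: (@family_rank_widen _ (k.+1 * 1)); first by rewrite muln1 ltnS.
  apply: iter_both_step_rank.
  exists [:: ((fun om => (om [::])%:M), 1%:M)]; split=> // om.
  by rewrite big_seq1 /= mulmx1 mul_scalar_mx.
apply: (family_rank_ext (fsym (crossingS j k))).
set n := (K.+1 * _ ^ j)%N in IHj.
have := @family_rank_sum _ (index_enum 'I_k) predT (fun i om =>
  iter i both_step (bd_step (crossing j (k - i.+1))) om)
  (K.+1 * (#|T| * (e * n))).
rewrite size_index_enum card_ord => hs; apply: family_rank_widen (hs _).
  rewrite expnS [X in (_ <= X)%N]mulnCA -/n -mulnn -!(mulnA K.+1) -!mulnA.
  by apply: leq_mul => //; apply: leqW.
move=> i _; apply: (@family_rank_widen _ (i.+1 * (#|T| * (e * n)))).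
  by rewrite leq_mul // (leq_trans (ltn_ord i)) // leqW.
apply: iter_both_step_rank; apply: bd_step_rank; apply: IHj.
by apply: leq_trans le_kK; apply: leq_subr.
Qed.

End CutRank.

(** * Attaching each word to its first sparsely crossed cut *)

Section FirstCut.
Variables (F : fieldType) (T : finType) (bd lt : nat -> pred T) (M c : nat).
Hypothesis bd_lt : forall q' q x, (q' < q < M)%N -> bd q' x -> lt q x.

(* Letters across an earlier cut lie to the left of q, so that this weight may be
   evaluated on the left letters only. *)
Definition late_cut (q : nat) (u : seq T) : F :=
  [forall i : 'I_q, (c < count (bd i) u)%N]%:R.

(** The indicator made explicit in [first_cutE], spelled as a sum over exact numbers of crossings
    with weights on the left letters, the shape that [crossing] requires. *)
Definition first_cut (q : nat) (w : seq T) : F :=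
  \sum_(j < c.+1) (count (bd q) w == j)%:R * late_cut q (seq.filter (lt q) w).

Lemma first_cutE q w : (q < M)%N -> first_cut q w =
  ((count (bd q) w <= c)%N && [forall i : 'I_q, (c < count (bd i) w)%N])%:R.
Proof.
move=> qM; rewrite /first_cut -mulr_suml -mulnb natrM; congr (_ * _%:R).
  case: leqP => [le_c|lt_c].
    have lt_c : (count (bd q) w < c.+1)%N by [].
    rewrite (bigD1 (Ordinal lt_c)) //= eqxx big1 ?addr0 // => j ne_j.
    case: eqP => // ej; case/eqP: ne_j; exact: val_inj.
  rewrite big1 // => j _; case: eqP => // ej.
  by move: lt_c; rewrite ej ltnNge -ltnS ltn_ord.
congr (nat_of_bool _); apply: eq_forallb => i; rewrite count_filter.
congr (c < _)%N; apply: eq_count => x /=.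
case bx: (bd i x) => //=; apply: bd_lt bx.
by rewrite ltn_ord.
Qed.

(** There is a unique least [q] among the cuts crossed at most [c] times, so these weights form a
    partition of unity. *)
Lemma sum_first_cut w :
  (exists2 q, (q < M)%N & (count (bd q) w <= c)%N) ->
  \sum_(q < M) first_cut q w = 1.
Proof.
case=> q qM cq; have ex : exists q, (count (bd q) w <= c)%N by exists q.
case: (ex_minnP ex) => q0 cq0 q0_min.
have q0M : (q0 < M)%N by apply: leq_ltn_trans qM; apply: q0_min.
rewrite (bigD1 (Ordinal q0M)) //= first_cutE // cq0.
have -> : [forall i : 'I_q0, (c < count (bd i) w)%N].
  apply/forallP => i; rewrite ltnNge; apply/negP => /q0_min.
  by rewrite leqNgt ltn_ord.
rewrite big1 ?addr0 // => i ne_i; rewrite first_cutE //.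
case: leqP => //= ci; case: forallP => // hi.
have lt_i : (q0 < i)%N.
  rewrite ltn_neqAle q0_min // andbT.
  by apply/negP => /eqP e; case/eqP: ne_i; apply: val_inj.
by have := hi (Ordinal lt_i); rewrite /= ltnNge cq0.
Qed.

Variables (V : lmodType F) (act : T -> V -> V) (p r : nat).
Variables (unf : nat -> {linear V -> 'M[F]_(p, r)}) (rt : nat -> pred T).
Variables (l : T -> 'M[F]_p) (rm : T -> 'M[F]_r) (e : nat).
Variable B : nat -> T -> seq ('M[F]_p * 'M[F]_r).
Hypothesis act_linear : forall x, linear (act x).
Hypothesis kindP : forall q x, (lt q x + rt q x + bd q x = 1)%N.
Hypothesis unf_left : forall q x u, lt q x -> unf q (act x u) = l x *m unf q u.
Hypothesis unf_right : forall q x u, rt q x -> unf q (act x u) = unf q u *m rm x.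
Hypothesis unf_bd : forall q x u, bd q x ->
  unf q (act x u) = \sum_(t <- B q x) t.1 *m unf q u *m t.2.
Hypothesis size_B : forall q x, (size (B q x) <= e)%N.

(** [unf q] need not be onto, so the action on matrices is defined by the kind of the letter; it
    agrees with [act] on unfolded vectors by [unf_act]. *)
Let act' q x (N : 'M[F]_(p, r)) : 'M[F]_(p, r) :=
  if lt q x then l x *m N else if rt q x then N *m rm x
  else \sum_(t <- B q x) t.1 *m N *m t.2.

Let act'_linear q x : linear (act' q x).
Proof.
move=> a u w; rewrite /act'; case: ifP => _.
  by rewrite mulmxDr scalemxAr.
case: ifP => _; first by rewrite mulmxDl scalemxAl.
rewrite scaler_sumr -big_split; apply: eq_bigr => t _ /=.
by rewrite mulmxDr mulmxDl -scalemxAr -scalemxAl.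
Qed.

Let unf_act q x u : unf q (act x u) = act' q x (unf q u).
Proof.
rewrite /act'; have := kindP q x.
case ltx: (lt q x); first by rewrite unf_left.
case rtx: (rt q x); first by rewrite unf_right.
by case bdx: (bd q x) => // _; rewrite unf_bd.
Qed.

Let act_left q x N : lt q x -> act' q x N = l x *m N.
Proof. by rewrite /act' => ->. Qed.

Let act_right q x N : rt q x -> act' q x N = N *m rm x.
Proof.
by rewrite /act' => rtx; have := kindP q x; rewrite rtx; case: (lt q x).
Qed.

Let act_bd q x N : bd q x -> act' q x N = \sum_(t <- B q x) t.1 *m N *m t.2.
Proof.
rewrite /act' => bdx; have := kindP q x; rewrite bdx.
by case: (lt q x) (rt q x) => -[].
Qed.

Lemma rank_sum_le (I : Type) (s : seq I) (N : I -> 'M[F]_(p, r)) b :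
  (forall i, \rank (N i) <= b)%N -> (\rank (\sum_(i <- s) N i)%R <= size s * b)%N.
Proof.
move=> hb; elim: s => [|i s IHs]; first by rewrite big_nil mxrank0.
by rewrite big_cons mulSn (leq_trans (mxrank_add _ _)) // leq_add.
Qed.

Lemma first_cut_rank psi k K q : (k <= K)%N -> (0 < #|T| * e)%N ->
  (\rank (unf q (wsum act psi k (first_cut q))) <=
     c.+1 * (K.+1 * (K.+1 ^ 2 * (#|T| * e)) ^ c * \rank (unf q psi)))%N.
Proof.
move=> kK e0; rewrite (wsum_sum act_linear) linear_sum.
rewrite -[X in (_ <= X * _)%N](card_ord c.+1) -(size_index_enum 'I_c.+1).
apply: rank_sum_le => j.
rewrite (wsum_morph _ _ _ (unf_act q)).
have := crossing_rank (unf q psi) (@act'_linear q) (@kindP q) (@act_left q)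
  (@act_right q) (@act_bd q) (@size_B q) j kK.
move/(@family_rank_rank _ _ _ _ _ _ _ (late_cut q)).
rewrite {1}/crossing => /leq_trans; apply.
(* Replacing [j] by [c] in the exponent needs a positive base. *)
rewrite leq_mul // leq_mul // leq_pexp2l //; last by rewrite -ltnS.
by rewrite muln_gt0 expn_gt0.
Qed.

(** Words are grouped by their first sparse cut and each group is bounded at its own cut. The factor
    [dl] is paid twice: once to bring the group back to [unfA], once to compare the ranks of [psi]
    at the cut and at [unfA]. *)
Lemma krylov_rank psi K (a : nat -> F) (unfA : {linear V -> 'M[F]_(p, r)}) dl :
  (0 < #|T| * e)%N ->
  (forall w, (size w <= K)%N ->
    exists2 q, (q < M)%N & (count (bd q) w <= c)%N) ->
  (forall q u, (q < M)%N -> \rank (unfA u) <= dl * \rank (unf q u))%N ->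
  (forall q u, (q < M)%N -> \rank (unf q u) <= dl * \rank (unfA u))%N ->
  (\rank (unfA (\sum_(k < K.+1) a k *: iter k (fun u => \sum_x act x u) psi)%R)
    <= K.+1 * (M * (dl ^ 2 * (c.+1 * (K.+1 * (K.+1 ^ 2 * (#|T| * e)) ^ c)
         * \rank (unfA psi)))))%N.
Proof.
move=> e0 cover toA fromA.
rewrite linear_sum -[X in (_ <= X * _)%N](card_ord K.+1) -(size_index_enum 'I_K.+1).
apply: rank_sum_le => k.
rewrite linearZ; apply: leq_trans (mxrank_scale _ _) _.
rewrite iter_wsum.
have -> : wsum act psi k (fun _ => 1) =
    \sum_(q < M) wsum act psi k (first_cut q).
  rewrite -(wsum_sum act_linear); apply: wsum_ext => w sz.
  by rewrite sum_first_cut //; apply: cover; rewrite sz -ltnS.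
rewrite linear_sum -[X in (_ <= X * _)%N](card_ord M) -(size_index_enum 'I_M).
apply: rank_sum_le => q.
have kK : (k <= K)%N by rewrite -ltnS.
have := first_cut_rank psi q kK e0; set X := (K.+1 * _)%N => hX.
apply: leq_trans (toA q _ (ltn_ord q)) _; rewrite -mulnn -mulnA leq_mul //.
apply: leq_trans hX _; rewrite mulnA mulnCA leq_mul //.
exact: fromA.
Qed.

End FirstCut.

(** * Matrices of amplitudes across a cut *)

Section Locality.
Variables (R : realType) (T : finType) (d : nat).
Implicit Types (f g k : config T d) (A S X Y : {set T}) (O : operator R T d).
Implicit Type phi : state R T d.

Definition agree A f g : bool := [forall x in A, f x == g x].

Lemma agreeP A f g : reflect {in A, forall x, f x = g x} (agree A f g).
Proof.
apply: (iffP forall_inP) => h x xA; first exact/eqP/h.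
by apply/eqP; apply: h.
Qed.

Lemma agree_sym A f g : agree A f g = agree A g f.
Proof. by apply: eq_forallb => x; rewrite eq_sym. Qed.

Lemma agree_restrict A f g :
  agree A f g = (restrict_config A f == restrict_config A g).
Proof.
apply/agreeP/eqP => [h|/ffunP h x xA].
  by apply/ffunP => y; rewrite !ffunE; apply: h; apply: (valP y).
by have := h (exist _ x xA); rewrite !ffunE.
Qed.

Definition mix A f g : config T d := [ffun x => if x \in A then f x else g x].

Definition entry O f g : R[i] := O (enum_rank f) (enum_rank g).

Definition amplitude phi f : R[i] := phi (enum_rank f) 0.

(** [supported_on] rephrased on full configurations, so that supports can be intersected and
    enlarged without changing index types. *)
Definition acts_on S O : Prop :=
  (forall f g, ~~ agree (~: S) f g -> entry O f g = 0) /\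
  (forall f g f' g', agree S f f' -> agree S g g' ->
     agree (~: S) f g -> agree (~: S) f' g' -> entry O f g = entry O f' g').

Lemma supported_acts_on S O : supported_on S O -> acts_on S O.
Proof.
case=> M hM; split=> [f g|f g f' g']; rewrite /entry !hM !agree_restrict.
  by move/negbTE->.
by move=> /eqP -> /eqP -> -> ->.
Qed.

Definition extend (f0 : config T d) S (a : config_on d S) : config T d :=
  [ffun x => if insub x is Some y then a y else f0 x].

Lemma restrict_extend f0 S (a : config_on d S) :
  restrict_config S (extend f0 a) = a.
Proof. by apply/ffunP => y; rewrite !ffunE valK. Qed.

Lemma extendE f0 S f x :
  extend f0 (restrict_config S f) x = if x \in S then f x else f0 x.
Proof. by rewrite ffunE; case: insubP => [y -> <-|/negbTE ->] //; rewrite ffunE. Qed.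

Lemma acts_on_supported f0 S O : acts_on S O -> supported_on S O.
Proof.
case=> h0 h1.
exists (\matrix_(a, b) entry O (extend f0 (enum_val a)) (extend f0 (enum_val b))).
move=> f g; rewrite mxE !enum_rankK -agree_restrict.
case: (boolP (agree _ _ _)) => [ag|/h0] //.
apply: h1 => //; apply/agreeP => x xS; rewrite !extendE ?xS //.
by move: xS; rewrite inE => /negbTE ->.
Qed.

Lemma acts_onT O : acts_on [set: T] O.
Proof.
split=> [f g|f g f' g' e1 e2 _ _].
  by rewrite finset.setCT => /negP[]; apply/agreeP => x; rewrite inE.
have -> : f = f' by apply/ffunP => x; apply: (agreeP _ _ _ e1).
by have -> : g = g' by apply/ffunP => x; apply: (agreeP _ _ _ e2).
Qed.

Lemma acts_onI X Y O : acts_on X O -> acts_on Y O -> acts_on (X :&: Y) O.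
Proof.
move=> [X0 X1] [Y0 Y1]; split=> [f g nag|f g f' g' /agreeP ff /agreeP gg].
  case: (boolP (agree (~: X) f g)) => [/agreeP aX|/X0 //].
  case: (boolP (agree (~: Y) f g)) => [/agreeP aY|/Y0 //].
  case/negP: nag; apply/agreeP => x; rewrite finset.setCI inE.
  by case/orP; [apply: aX|apply: aY].
move=> /agreeP fg /agreeP fg'.
(* First the sites off [X] are changed, by locality on [X]; then the rest, inside [X] and off [Y],
   by locality on [Y]. *)
rewrite (X1 f g (mix X f f') (mix X g g')).
- apply: Y1; apply/agreeP => x xY; rewrite ?ffunE; try case: ifP => // xX.
  + by apply: ff; rewrite inE xX.
  + by apply: gg; rewrite inE xX.
  + by apply: fg; move: xY; rewrite !inE negb_and orbC => ->.
  + by apply: fg'; rewrite !inE xX.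
  by apply: fg'; move: xY; rewrite !inE negb_and orbC => ->.
- by apply/agreeP => x xX; rewrite ffunE xX.
- by apply/agreeP => x xX; rewrite ffunE xX.
- by apply/agreeP => x xX; apply: fg; rewrite finset.setCI inE xX.
apply/agreeP => x xX; rewrite !ffunE.
move: (xX); rewrite inE => /negbTE ->.
by apply: fg'; rewrite finset.setCI inE xX.
Qed.

(** [op_support] is defined one site at a time; intersecting over the sites of [A] gives locality on
    the whole complement. *)
Lemma acts_onC A O :
  {in A, forall y, supported_on (~: [set y]) O} -> acts_on (~: A) O.
Proof.
move=> hA; have {hA} : forall y, y \in enum A -> acts_on (~: [set y]) O.
  by move=> y; rewrite mem_enum => /hA /supported_acts_on.
have -> : ~: A = ~: [set x | x \in enum A].
  by apply/setP => x; rewrite !inE mem_enum.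
elim: (enum A) => [|y s IHs] hs.
  have -> : ~: [set x : T | x \in [::]] = [set: T]; last exact: acts_onT.
  by apply/setP => x; rewrite !inE.
have -> : ~: [set x | x \in y :: s] = ~: [set y] :&: ~: [set x | x \in s].
  by apply/setP => x; rewrite !inE negb_or.
apply: acts_onI; first by apply: hs; rewrite inE eqxx.
by apply: IHs => z zs; apply: hs; rewrite inE zs orbT.
Qed.

Lemma acts_on_sub X Y O : X \subset Y -> acts_on X O -> acts_on Y O.
Proof.
move=> /fintype.subsetP XY [X0 X1]; split=> [f g nag|f g f' g' /agreeP ff /agreeP gg].
  apply: X0; apply: contra nag => /agreeP ag; apply/agreeP => x.
  by rewrite inE => xY; apply: ag; rewrite inE; apply: contra xY => /XY.
move=> /agreeP fg /agreeP fg'.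
case: (boolP (agree (~: X) f g)) => [ag|nag]; last first.
  rewrite !X0 //; apply: contra nag => /agreeP ag; apply/agreeP => x xX.
  case: (boolP (x \in Y)) => xY; last by apply: fg; rewrite inE.
  by rewrite ff // gg // ag.
apply: X1 => //; apply/agreeP => x xX; [exact: ff (XY _ _)|exact: gg (XY _ _)|].
case: (boolP (x \in Y)) => xY; last by apply: fg'; rewrite inE.
by rewrite -ff // -gg //; apply: (agreeP _ _ _ ag).
Qed.

Lemma sub_op_support f0 S O : supported_on S O -> op_support O \subset S.
Proof.
move=> /supported_acts_on hS; apply/fintype.subsetP => y; rewrite inE.
apply: contraR => yS; apply/asboolP; apply: (acts_on_supported f0).
apply: acts_on_sub hS; apply/fintype.subsetP => x xS; rewrite !inE.
by apply: contraNneq yS => <-.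
Qed.

Lemma acts_on_op_support A O :
  op_support O :&: A = finset.set0 -> acts_on (~: A) O.
Proof.
move=> e0; apply: acts_onC => y yA.
have : y \notin op_support O :&: A by rewrite e0 inE.
by rewrite !inE yA andbT negbK => /asboolP.
Qed.

Lemma amplitude_mul O phi f :
  amplitude (O *m phi) f = \sum_g entry O f g * amplitude phi g.
Proof.
rewrite /amplitude mxE (reindex enum_rank) //.
exact: onW_bij (@enum_rank_bij _).
Qed.

(* The matrix of amplitudes across the cut A, with rows and columns indexed by
   full configurations although only their parts in and out of A matter. *)
Definition unfold A phi : 'M[R[i]]_#|config T d| :=
  \matrix_(i, j) amplitude phi (mix A (enum_val i) (enum_val j)).

Lemma unfoldE A phi f g :
  entry (unfold A phi) f g = amplitude phi (mix A f g).
Proof. by rewrite /entry mxE !enum_rankK. Qed.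

Lemma unfold_is_linear A : linear (unfold A).
Proof. by move=> a u w; apply/matrixP => i j; rewrite !mxE /amplitude !mxE. Qed.

HB.instance Definition _ A := GRing.isLinear.Build R[i] (state R T d)
  'M[R[i]]_#|config T d| _ (unfold A) (@unfold_is_linear A).

Lemma eq_entry O P : (forall f g, entry O f g = entry P f g) -> O = P.
Proof.
move=> h; apply/matrixP => i j.
by have := h (enum_val i) (enum_val j); rewrite /entry !enum_valK.
Qed.

Lemma entry_mul O P f g :
  entry (O *m P) f g = \sum_k entry O f k * entry P k g.
Proof.
rewrite /entry mxE (reindex enum_rank) //.
exact: onW_bij (@enum_rank_bij _).
Qed.

Lemma mix_agree A f g k : agree (~: A) f k -> mix A f k = f.
Proof.
move=> /agreeP h; apply/ffunP => x; rewrite ffunE; case: ifP => // /negbT xA.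
by rewrite h // inE.
Qed.

(** [L] fixes the row configuration off [A] and [Q] the column configuration on [A], so what remains
    free in the two intermediate configurations amounts to a single [k]. *)
Lemma entry_sandwich A (L Q : operator R T d) phi f g :
  (forall f f', ~~ agree (~: A) f f' -> entry L f f' = 0) ->
  (forall g' g, ~~ agree A g' g -> entry Q g' g = 0) ->
  entry (L *m unfold A phi *m Q) f g =
  \sum_k entry L f (mix A k f) * entry Q (mix A g k) g * amplitude phi k.
Proof.
move=> hL hQ; rewrite -mulmxA entry_mul.
under eq_bigr => f' _ do rewrite entry_mul mulr_sumr.
rewrite pair_big /=.
rewrite (bigID (fun p => agree (~: A) f p.1 && agree A p.2 g)) /=.
rewrite [X in _ + X]big1 ?addr0; last first.
  move=> p; rewrite negb_and => /orP[/hL ->|/hQ ->]; first by rewrite mul0r.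
  by rewrite !mulr0.
rewrite (reindex_onto (fun k => (mix A k f, mix A g k))
  (fun p => mix A p.1 p.2)) /=; last first.
  move=> [f' g'] /= /andP[/agreeP h1 /agreeP h2]; congr (_, _).
    apply/ffunP => x; rewrite !ffunE; case: (boolP (x \in A)) => // xA.
    by rewrite h1 // inE.
  by apply/ffunP => x; rewrite !ffunE; case: (boolP (x \in A)) => // /h2.
apply: eq_big => [k|k _].
  apply/andP; split; first (apply/andP; split).
  - by apply/agreeP => x; rewrite !inE ffunE => /negbTE ->.
  - by apply/agreeP => x xA; rewrite ffunE xA.
  by apply/eqP/ffunP => x; rewrite !ffunE; case: (x \in A).
rewrite unfoldE mulrA mulrAC; congr (_ * amplitude phi _).
by apply/ffunP => x; rewrite !ffunE; case: (x \in A).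
Qed.

Lemma entry1 f g : entry 1%:M f g = (f == g)%:R.
Proof. by rewrite /entry mxE (inj_eq enum_rank_inj). Qed.

Lemma agree_mix A f k : (mix A f k == f) = agree (~: A) f k.
Proof.
apply/eqP/idP => [<-|]; last exact: mix_agree.
by apply/agreeP => x; rewrite inE ffunE => /negbTE ->.
Qed.

Lemma agree_mixC A f k : (mix A k f == f) = agree A k f.
Proof.
apply/eqP/agreeP => [<- x xA|h]; first by rewrite ffunE xA.
by apply/ffunP => x; rewrite ffunE; case: ifP => // /h.
Qed.

(** Both sides are sums over one configuration, by [entry_sandwich] with the identity as right
    factor; locality of [O] and the identity kill the same terms. *)
Lemma unfold_left A O phi :
  acts_on A O -> unfold A (O *m phi) = O *m unfold A phi.
Proof.
move=> [loc0 loc1]; rewrite -[RHS]mulmx1; apply: eq_entry => f g.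
rewrite entry_sandwich //; last first.
  move=> g' h; rewrite entry1; case: eqP => // -> /negP[].
  by apply/agreeP.
rewrite unfoldE amplitude_mul; apply: eq_bigr => k _; congr (_ * _).
rewrite entry1 agree_mix agree_sym.
case: (boolP (agree _ _ _)) => [/agreeP kg|kg]; last first.
  rewrite mulr0; apply: loc0; apply: contra kg => /agreeP kg; apply/agreeP => x xA.
  by rewrite -kg // ffunE; move: xA; rewrite inE => /negbTE ->.
rewrite mulr1; apply: loc1; apply/agreeP => x; rewrite ?ffunE ?inE => xA.
- by rewrite xA.
- by rewrite xA.
- by rewrite (negbTE xA) kg ?inE.
by rewrite (negbTE xA).
Qed.

(** The sites off [A] are carried by the column index, hence the transpose. *)
Lemma unfold_right A O phi :
  acts_on (~: A) O -> unfold A (O *m phi) = unfold A phi *m O^T.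
Proof.
move=> [loc0 loc1]; rewrite -[unfold A phi in RHS]mul1mx; apply: eq_entry => f g.
rewrite entry_sandwich; first last.
- move=> g' h nag; rewrite /entry mxE; apply: loc0; rewrite finset.setCK.
  by rewrite agree_sym.
- move=> h f'; rewrite entry1; case: eqP => // -> /negP[].
  by apply/agreeP.
rewrite unfoldE amplitude_mul; apply: eq_bigr => k _; congr (_ * _).
rewrite entry1 eq_sym agree_mixC.
case: (boolP (agree _ _ _)) => [/agreeP kf|kf]; last first.
  rewrite mul0r; apply: loc0; rewrite finset.setCK; apply: contra kf => /agreeP kf.
  by apply/agreeP => x xA; rewrite -kf // ffunE xA.
rewrite mul1r {2}/entry mxE -/(entry O _ _).
apply: loc1; apply/agreeP => x; rewrite ?ffunE ?inE ?negbK => xA.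
- by rewrite (negbTE xA).
- by rewrite (negbTE xA).
- by rewrite xA kf.
by rewrite xA.
Qed.

Lemma card_config_on S : #|config_on d S| = (d ^ #|S|)%N.
Proof. by rewrite card_ffun card_ord card_sig. Qed.

(* The terms are indexed by the pairs of configurations of S. *)
Lemma unfold_boundary (f0 : config T d) A S O :
  acts_on S O -> exists B : seq (operator R T d * operator R T d),
    (size B = d ^ (2 * #|S|))%N /\
    forall phi, unfold A (O *m phi) = \sum_(t <- B) t.1 *m unfold A phi *m t.2.
Proof.
move=> [loc0 loc1].
pose ex (s : config_on d S) := extend f0 s.
(* [O] is expanded in matrix units on [S], from [s.2] to [s.1]. [Lm] takes their part in [A]
   together with the coefficient, [Qm] the part off [A], transposed. *)
pose Lm (s : config_on d S * config_on d S) : operator R T d := \matrix_(i, j)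
  (entry O (ex s.1) (ex s.2) *
   [&& agree (A :&: S) (enum_val i) (ex s.1),
       agree (A :&: S) (enum_val j) (ex s.2),
       agree (A :\: S) (enum_val i) (enum_val j)
     & agree (~: A) (enum_val i) (enum_val j)]%:R).
pose Qm (s : config_on d S * config_on d S) : operator R T d := \matrix_(i, j)
  [&& agree (S :\: A) (enum_val j) (ex s.1),
      agree (S :\: A) (enum_val i) (ex s.2),
      agree (~: (A :|: S)) (enum_val i) (enum_val j)
    & agree A (enum_val i) (enum_val j)]%:R.
exists [seq (Lm s, Qm s) | s <- index_enum (config_on d S * config_on d S)%type].
split.
  rewrite size_map size_index_enum card_prod card_config_on -expnD.
  by rewrite mul2n addnn.
move=> phi; rewrite big_map; apply: eq_entry => f g.
rewrite unfoldE amplitude_mul.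
have -> : entry (\sum_s Lm s *m unfold A phi *m Qm s) f g =
  \sum_s entry (Lm s *m unfold A phi *m Qm s) f g.
  by rewrite /entry summxE.
have hL s h h' : ~~ agree (~: A) h h' -> entry (Lm s) h h' = 0.
  by rewrite /entry mxE !enum_rankK => /negbTE ->; rewrite !andbF mulr0.
have hQ s h h' : ~~ agree A h h' -> entry (Qm s) h h' = 0.
  by rewrite /entry mxE !enum_rankK => /negbTE ->; rewrite !andbF.
under [RHS]eq_bigr => s _ do rewrite (entry_sandwich _ _ _ (hL s) (hQ s)).
rewrite exchange_big; apply: eq_bigr => k _; rewrite -mulr_suml.
congr (_ * _).
set F := mix A f g.
have term s : entry (Lm s) f (mix A k f) * entry (Qm s) (mix A g k) g =
    entry O (ex s.1) (ex s.2) *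
    [&& agree S F (ex s.1), agree S k (ex s.2) & agree (~: S) F k]%:R.
  rewrite /entry !mxE !enum_rankK -mulrA -natrM mulnb; congr (_ * (nat_of_bool _)%:R).
  apply/idP/idP.
    case/andP => /and4P[/agreeP a1 /agreeP a2 /agreeP a3 _].
    case/and4P => /agreeP b1 /agreeP b2 /agreeP b3 _.
    apply/and3P; split; apply/agreeP => x xS.
    - rewrite ffunE; case: ifP => xA; first by apply: a1; rewrite inE xA.
      by apply: b1; rewrite !inE xA.
    - case xA: (x \in A); first by rewrite -a2 ?inE ?xA // ffunE xA.
      by rewrite -b2 ?inE ?xA // ffunE xA.
    move: xS; rewrite !inE !ffunE => xS; case xA: (x \in A).
      by rewrite a3 ?inE ?xA ?xS // ffunE xA.
    by rewrite -b3 ?inE ?xA ?xS // ffunE xA.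
  case/and3P => /agreeP a1 /agreeP a2 /agreeP a3.
  apply/andP; split; apply/and4P; split; apply/agreeP => x; rewrite ?inE.
  - by case/andP => xA xS; rewrite -a1 // ffunE xA.
  - by case/andP => xA xS; rewrite -a2 // ffunE xA.
  - by case/andP => xS xA; rewrite ffunE xA -a3 ?inE // ffunE xA.
  - by move=> /negbTE xA; rewrite ffunE xA.
  - by case/andP => /negbTE xA xS; rewrite -a1 // ffunE xA.
  - by case/andP => /negbTE xA xS; rewrite -a2 // ffunE xA.
  - rewrite negb_or => /andP[/negbTE xA xS].
    by rewrite ffunE xA -a3 ?inE // ffunE xA.
  by move=> xA; rewrite ffunE xA.
under eq_bigr => s _ do rewrite term.
rewrite (bigD1 (restrict_config S F, restrict_config S k)) //= big1 ?addr0.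
  rewrite !agree_restrict /ex !restrict_extend !eqxx /= -agree_restrict.
  case: (boolP (agree _ _ _)) => [ag|/loc0 ->]; last by rewrite mulr0.
  rewrite mulr1; apply: loc1 => //; apply/agreeP => x xS; rewrite !extendE ?xS //.
  by move: xS; rewrite inE => /negbTE ->.
case=> s1 s2 /= ne; rewrite !agree_restrict /ex !restrict_extend.
case: eqP => [e1|_]; last by rewrite mulr0.
case: eqP => [e2|_]; last by rewrite mulr0.
by case/eqP: ne; rewrite e1 e2.
Qed.

(* Only the configuration on the symmetric difference has to be fixed to pass
   from one cut to the other. *)
Lemma unfold_change (f0 : config T d) A S phi :
  (\rank (unfold A phi) <=
     d ^ #|(A :\: S) :|: (S :\: A)| * \rank (unfold S phi))%N.
Proof.
set D := _ :|: _.
pose ex (s : config_on d D) := extend f0 s.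
(* [s] prescribes the values on [D]. Rows keep their values on [A :&: S], columns theirs off
   [A :|: S], and [s] supplies those that change sides. *)
pose P s : operator R T d := \matrix_(i, j)
  (agree (A :\: S) (enum_val i) (ex s) &&
   (enum_val j == mix (A :&: S) (enum_val i) (ex s)))%:R.
pose Q s : operator R T d := \matrix_(i, j)
  (agree (S :\: A) (enum_val j) (ex s) &&
   (enum_val i == mix (A :|: S) (ex s) (enum_val j)))%:R.
have -> : unfold A phi = \sum_s P s *m unfold S phi *m Q s.
  apply: eq_entry => f g.
  have -> : entry (\sum_s P s *m unfold S phi *m Q s) f g =
    \sum_s entry (P s *m unfold S phi *m Q s) f g.
    by rewrite /entry summxE.
  have term s : entry (P s *m unfold S phi *m Q s) f g =
      (agree D (mix A f g) (ex s))%:R * amplitude phi (mix A f g).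
    rewrite -mulmxA entry_mul (bigD1 (mix (A :&: S) f (ex s))) //= big1 => [|h ne].
      rewrite addr0 entry_mul (bigD1 (mix (A :|: S) (ex s) g)) //= big1 => [|h ne].
        rewrite addr0 unfoldE /entry !mxE !enum_rankK !eqxx !andbT.
        rewrite mulrA mulrAC -natrM mulnb.
        have -> : agree (A :\: S) f (ex s) && agree (S :\: A) g (ex s) =
                  agree D (mix A f g) (ex s).
          apply/andP/agreeP => [[/agreeP a1 /agreeP a2] x|h].
            rewrite !inE ffunE; case xA: (x \in A) => /=.
              by rewrite orbF => xS; apply: a1; rewrite !inE xA xS.
            by rewrite andbF => /= xS; apply: a2; rewrite !inE xA xS.
          split; apply/agreeP => x; rewrite !inE => /andP[x1 x2].
            by rewrite -h ?ffunE ?x2 // !inE x1 x2.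
          by rewrite -h ?ffunE ?(negbTE x1) // !inE x1 x2 orbT.
        case: (boolP (agree _ _ _)) => [/agreeP ag|_]; last by rewrite !mul0r.
        congr (_ * amplitude phi _); apply/ffunP => x.
        have := ag x; rewrite !ffunE !inE.
        by case: (x \in A) (x \in S) => -[] //= <-.
      by rewrite [X in _ * X]/entry mxE !enum_rankK (negbTE ne) andbF mulr0.
    by rewrite {1}/entry mxE !enum_rankK (negbTE ne) andbF mul0r.
  under eq_bigr => s _ do rewrite term.
  rewrite (bigD1 (restrict_config D (mix A f g))) //= big1 ?addr0.
    by rewrite agree_restrict restrict_extend eqxx mul1r unfoldE.
  move=> s ne; rewrite agree_restrict restrict_extend eq_sym.
  by rewrite (negbTE ne) mul0r.
rewrite -card_config_on -(size_index_enum (config_on d D)).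
elim: (index_enum _) => [|s r IHr]; first by rewrite big_nil mxrank0.
rewrite big_cons mulSn; apply: leq_trans (mxrank_add _ _) (leq_add _ IHr).
by apply: leq_trans (mxrankM_maxl _ _) (mxrankM_maxr _ _).
Qed.

(** * Rank of the reduced density matrix *)

Definition glue (f0 : config T d) A (a : config_on d A) (b : config_on d (~: A)) :=
  mix A (extend f0 a) (extend f0 b).

Lemma restrict_glue f0 A a b : restrict_config A (glue f0 (A := A) a b) = a.
Proof.
by apply/ffunP => x; rewrite !ffunE (valP x) valK.
Qed.

Lemma restrict_glueC f0 A a b : restrict_config (~: A) (glue f0 (A := A) a b) = b.
Proof.
apply/ffunP => x; rewrite !ffunE.
by have := valP x; rewrite inE => /negbTE ->; rewrite valK.
Qed.

Lemma glue_restrict f0 A f :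
  glue f0 (restrict_config A f) (restrict_config (~: A) f) = f.
Proof.
by apply/ffunP => x; rewrite ffunE !extendE inE; case: (x \in A).
Qed.

(** [unfold A phi] without its repeated rows and columns, so that its product with its adjoint is
    exactly the reduced density matrix. *)
Definition schmidt_mx (f0 : config T d) A phi :
    'M[R[i]]_(#|config_on d A|, #|config_on d (~: A)|) :=
  \matrix_(i, j) amplitude phi (glue f0 (enum_val i) (enum_val j)).

(** Each matrix arises from the other by selecting or repeating rows and columns, that is, by
    multiplication with 0-1 matrices on both sides. *)
Lemma rank_schmidt f0 A phi :
  \rank (schmidt_mx f0 A phi) = \rank (unfold A phi).
Proof.
apply/eqP; rewrite eqn_leq; apply/andP; split.
  have -> : schmidt_mx f0 A phi =
    (\matrix_(i, j) (enum_val j == extend f0 (enum_val i))%:R) *m unfold A phi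
    *m (\matrix_(i, j) (enum_val i == extend f0 (enum_val j))%:R).
    apply/matrixP => i j; rewrite -mulmxA !mxE.
    rewrite (bigD1 (enum_rank (extend f0 (enum_val i)))) //= big1 => [|k ne].
      rewrite !mxE !enum_rankK eqxx mul1r addr0.
      rewrite (bigD1 (enum_rank (extend f0 (enum_val j)))) //= big1 => [|k ne].
        by rewrite !mxE !enum_rankK eqxx mulr1 addr0.
      rewrite !mxE; case: eqP => [e|]; last by rewrite mulr0.
      by case/eqP: ne; rewrite -e enum_valK.
    rewrite !mxE; case: eqP => [e|]; last by rewrite mul0r.
    by case/eqP: ne; rewrite -e enum_valK.
  by apply: leq_trans (mxrankM_maxl _ _) (mxrankM_maxr _ _).
have -> : unfold A phi =
  (\matrix_(i, j) (enum_val j == restrict_config A (enum_val i))%:R)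
  *m schmidt_mx f0 A phi
  *m (\matrix_(i, j) (enum_val i == restrict_config (~: A) (enum_val j))%:R).
  apply/matrixP => i j; rewrite -mulmxA !mxE.
  rewrite (bigD1 (enum_rank (restrict_config A (enum_val i)))) //= big1 => [|k ne].
    rewrite !mxE !enum_rankK eqxx mul1r addr0.
    rewrite (bigD1 (enum_rank (restrict_config (~: A) (enum_val j)))) //=.
    rewrite big1 => [|k ne].
      rewrite !mxE !enum_rankK eqxx mulr1 addr0; congr (amplitude phi _).
      apply/ffunP => x; rewrite [LHS]ffunE [RHS]ffunE !extendE inE.
      by case: (x \in A).
    rewrite !mxE; case: eqP => [e|]; last by rewrite mulr0.
    by case/eqP: ne; rewrite -e enum_valK.
  rewrite !mxE; case: eqP => [e|]; last by rewrite mul0r.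
  by case/eqP: ne; rewrite -e enum_valK.
by apply: leq_trans (mxrankM_maxl _ _) (mxrankM_maxr _ _).
Qed.

Lemma reduced_schmidt f0 A phi :
  reduced A (projector phi) = schmidt_mx f0 A phi *m (schmidt_mx f0 A phi) ^t*.
Proof.
apply/matrixP => i j; rewrite !mxE.
rewrite (reindex_onto (fun b => glue f0 (enum_val i) (enum_val b))
  (fun f => enum_rank (restrict_config (~: A) f))) /=; last first.
  by move=> f /eqP <-; rewrite enum_rankK glue_restrict.
apply: eq_big => [b|b _].
  by rewrite restrict_glue restrict_glueC enum_valK !eqxx.
rewrite (bigD1 (glue f0 (enum_val j) (enum_val b))) /=; last first.
  by rewrite !restrict_glue !restrict_glueC !eqxx.
rewrite big1 ?addr0 => [|g /andP[/andP[/eqP g1 /eqP g2] /eqP[]]]; last first.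
  by rewrite -(glue_restrict f0 A g) g1 g2 restrict_glueC.
by rewrite !mxE big_ord1 !mxE.
Qed.

(** The kernel of [W ^t*] is orthogonal to the row space of [W], so multiplying by the adjoint loses
    no rank. *)
Lemma rank_gram m n (W : 'M[R[i]]_(m, n)) : \rank (W *m W ^t*) = \rank W.
Proof.
have cap0 : (W :&: kermx (W ^t*) = 0)%MS.
  rewrite capmxC; apply: orthomx_disj; apply/orthomx1P.
  exact: mulmx_ker.
by have := mxrank_mul_ker W (W ^t*); rewrite cap0 mxrank0 addn0.
Qed.

Lemma rank_reduced (f0 : config T d) A phi :
  \rank (reduced A (projector phi)) = \rank (unfold A phi).
Proof. by rewrite (reduced_schmidt f0) rank_gram rank_schmidt. Qed.

End Locality.

(** * Energies *)

Section Inner.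
Variables (R : realType) (T : finType) (d : nat).
Implicit Types (u v w : state R T d) (O : operator R T d).

Lemma innerE u v : inner u v = \sum_k (u k 0)^* * v k 0.
Proof. by rewrite /inner mxE; apply: eq_bigr => k _; rewrite !mxE. Qed.

Lemma innerDr u v w : inner u (v + w) = inner u v + inner u w.
Proof. by rewrite /inner mulmxDr mxE. Qed.

Lemma innerZr u v a : inner u (a *: v) = a * inner u v.
Proof. by rewrite /inner -scalemxAr mxE. Qed.

Lemma inner0r u : inner u 0 = 0.
Proof. by rewrite /inner mulmx0 mxE. Qed.

Lemma inner_sumr (I : Type) (r : seq I) u (F : I -> state R T d) :
  inner u (\sum_(i <- r) F i) = \sum_(i <- r) inner u (F i).
Proof. by apply: (big_morph (inner u)) => [v w|]; rewrite ?innerDr ?inner0r. Qed.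

Lemma innerC u v : inner v u = (inner u v)^*.
Proof.
rewrite !innerE rmorph_sum; apply: eq_bigr => k _.
by rewrite rmorphM /= conjCK mulrC.
Qed.

Lemma innerZl u v a : inner (a *: u) v = a^* * inner u v.
Proof. by rewrite innerC innerZr rmorphM /= -innerC. Qed.

Lemma innerDl u v w : inner (u + w) v = inner u v + inner w v.
Proof. by rewrite innerC innerDr rmorphD /= -!innerC. Qed.

Lemma inner_suml (I : Type) (r : seq I) u (F : I -> state R T d) :
  inner (\sum_(i <- r) F i) u = \sum_(i <- r) inner (F i) u.
Proof.
by rewrite innerC inner_sumr rmorph_sum; apply: eq_bigr => i _; rewrite [RHS]innerC.
Qed.

Lemma inner_ge0 v : 0 <= inner v v.
Proof.
by rewrite innerE; apply: sumr_ge0 => k _; rewrite mulrC mul_conjC_ge0.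
Qed.

Lemma inner_hermitian O u v :
  O \is hermsymmx -> inner u (O *m v) = inner (O *m u) v.
Proof.
move=> /is_hermitianmxP; rewrite expr0 scale1r => hO.
rewrite /inner mulmxA; congr ((_ *m _) 0 0).
by rewrite [in LHS]hO trmx_mul map_mxM.
Qed.

Lemma Re_inner_ge0 v : 0 <= complex.Re (inner v v).
Proof. by have := inner_ge0 v; rewrite lecE => /andP[]. Qed.

(* Cauchy-Schwarz, from the positivity of |w - t v|^2 with t = Re <v, w>. *)
Lemma Re_inner_le v w : normalized v -> complex.Re (inner v w) <= vnorm w.
Proof.
rewrite /normalized /vnorm => nv; set t := complex.Re (inner v w).
have [t0|t0] := ltP t 0; first by apply: ltW; apply: lt_le_trans t0 (sqrtr_ge0 _).
rewrite -[leLHS](ger0_norm t0) -sqrtr_sqr ler_wsqrtr //.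
have := Re_inner_ge0 (w + (- t)%:C *: v).
rewrite innerDl !innerDr !innerZr !innerZl nv (innerC v w) mulr1.
rewrite [complex.Re _]raddfD /=.
have -> : (- t)%:C^* = (- t)%:C :> R[i] by apply/eqP; rewrite -[_ == _]/(conjc _ == _) conjc_real.
move: t0; rewrite /t; case: (inner v w) => a b a0.
rewrite -[(_ +i* _)^*]/(_ -i* _) /=; rewrite /= in a0.
case: (inner w w) => p q /=; nra.
Qed.

(** Ensures that [opnorm] is a true supremum rather than a default value. Components of a normalized
    vector have modulus at most 1, which gives the crude bound by row sums. *)
Lemma opnorm_has_ubound O :
  has_ubound [set vnorm (O *m v) | v in [set v : state R T d | normalized v]]%classic.
Proof.
pose C : R[i] := \sum_i (\sum_j `|O i j|) ^+ 2.
exists (Num.sqrt (complex.Re C)) => _ [v nv <-]; rewrite /vnorm.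
apply: ler_wsqrtr.
suff : inner (O *m v) (O *m v) <= C by rewrite lecE => /andP[].
rewrite innerE; apply: ler_sum => i _.
rewrite mulrC -normCK lerXn2r ?nnegrE ?normr_ge0 ?sumr_ge0 //.
rewrite mxE; apply: le_trans (ler_norm_sum _ _ _) _; apply: ler_sum => j _.
rewrite normrM ler_piMr //.
rewrite -(@expr_le1 _ 2) // normCK mulrC.
move: nv; rewrite /= /normalized innerE => <-.
rewrite (bigD1 j) //= lerDl; apply: sumr_ge0 => k _.
by rewrite mulrC mul_conjC_ge0.
Qed.

Lemma expectation_le_opnorm O v :
  normalized v -> complex.Re (inner v (O *m v)) <= opnorm O.
Proof.
move=> nv; apply: le_trans (Re_inner_le _ nv) _.
by apply: (ub_le_sup (opnorm_has_ubound O)); exists v.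
Qed.

Lemma hermitian_hamiltonian (hx : T -> operator R T d) :
  (forall x, hx x \is hermsymmx) -> hamiltonian hx \is hermsymmx.
Proof.
move=> hh; apply/is_hermitianmxP; rewrite expr0 scale1r /hamiltonian.
rewrite raddf_sum /= map_mx_sum; apply: eq_bigr => x _.
by have /is_hermitianmxP := hh x; rewrite expr0 scale1r.
Qed.

Lemma eigenstate_energy_ge0 O E v : O \is hermsymmx ->
  ground_energy O 0 -> energy_eigenstate O E v -> 0 <= E.
Proof.
move=> hO [_ hmin] [nv Ev]; apply: hmin; apply/eigenvalueP.
(* [eigenvalue] is about row vectors, so the adjoint of [v] is the witness; [O] being hermitian, it
   has the same energy. *)
exists (v ^t*).
  have /is_hermitianmxP := hO; rewrite expr0 scale1r => hO'.
  rewrite {1}hO' -map_mxM -trmx_mul Ev; apply/matrixP => i j; rewrite !mxE.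
  by rewrite rmorphM /= -[(E%:C)^*]/(conjc E%:C) conjc_real.
apply/negP => /eqP v0; have : inner v v = 0 by rewrite /inner v0 mul0mx mxE.
by rewrite nv => /eqP; rewrite oner_eq0.
Qed.

(** The energy is the sum of the expectations of the terms, each at most the norm of the term. *)
Lemma eigenstate_energy_le (hx : T -> operator R T d) h E v :
  (forall x, opnorm (hx x) <= h) ->
  energy_eigenstate (hamiltonian hx) E v -> E <= h * #|T|%:R.
Proof.
move=> hh [nv Ev].
have -> : E = complex.Re (inner v (hamiltonian hx *m v)).
  by rewrite Ev innerZr nv mulr1.
rewrite /hamiltonian mulmx_suml inner_sumr raddf_sum /=.
rewrite mulr_natr -sumr_const; apply: ler_sum => x _.
exact: le_trans (expectation_le_opnorm _ nv) (hh x).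
Qed.

Lemma eigenstate_orthogonal O E E' v v' : O \is hermsymmx ->
  energy_eigenstate O E v -> energy_eigenstate O E' v' -> E != E' ->
  inner v v' = 0.
Proof.
move=> hO [_ Ev] [_ Ev'] ne; have := inner_hermitian v v' hO.
rewrite Ev Ev' innerZr innerZl -[(E%:C)^*]/(conjc E%:C) conjc_real.
move/eqP; rewrite -subr_eq0 -mulrBl mulf_eq0 => /orP[|/eqP //].
by rewrite subr_eq0 (inj_eq (@complexI R)) eq_sym (negbTE ne).
Qed.

Variables (O : operator R T d) (n : nat) (E : 'I_n -> R).
Variables (v : 'I_n -> state R T d) (c : 'I_n -> R[i]).
Hypothesis hO : O \is hermsymmx.
Hypothesis E_inj : injective E.
Hypothesis hv : forall j, energy_eigenstate O (E j) (v j).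
Let psi := \sum_j c j *: v j.

Definition weight (a : R[i]) : R := complex.Re a ^+ 2 + complex.Im a ^+ 2.

Lemma weightE a : a^* * a = (weight a)%:C.
Proof. by rewrite add_Re2_Im2 mulrC normCK. Qed.

(** The [s j] stand for the factors by which a function of [O] acts on the [v j]. Factors 1 give the
    norm of [psi], truncated exponentials the fidelity. *)
Lemma inner_spectral (s : 'I_n -> R[i]) :
  inner psi (\sum_j s j *: (c j *: v j)) = \sum_j (weight (c j))%:C * s j.
Proof.
rewrite /psi inner_suml; apply: eq_bigr => j _.
rewrite inner_sumr (bigD1 j) //= big1 ?addr0 => [|k ne].
  by rewrite innerZl !innerZr (hv j).1 mulr1 [_ * c j]mulrC mulrA weightE mulrC.
rewrite innerZl !innerZr (eigenstate_orthogonal hO (hv j) (hv k)) ?mulr0 //.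
by rewrite (inj_eq E_inj) eq_sym.
Qed.

Lemma sum_weight : normalized psi -> \sum_j weight (c j) = 1.
Proof.
rewrite /normalized => npsi; apply: (@complexI R).
rewrite rmorph_sum /= -[RHS]npsi.
have e : \sum_j 1 *: (c j *: v j) = psi.
  by apply: eq_bigr => j _; rewrite scale1r.
rewrite -[X in inner _ X]e inner_spectral.
by apply: eq_bigr => j _; rewrite mulr1.
Qed.

Lemma eigenstate_expr E0 w k :
  O *m w = E0 *: w -> O ^+ k *m w = E0 ^+ k *: w.
Proof.
move=> Ow; elim: k => [|k IHk]; first by rewrite !expr0 mul1mx scale1r.
by rewrite exprS -mulmxA IHk -scalemxAr Ow scalerA -exprSr.
Qed.

End Inner.

(** * Fidelity and spacing of the energies *)

Section ComplexLimits.
Variable R : realType.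
Implicit Types (u : nat -> R[i]) (l a : R[i]) (x : R).

Definition ccvg u l : Prop :=
  ((complex.Re (u n) @[n --> \oo] --> complex.Re l) /\
   (complex.Im (u n) @[n --> \oo] --> complex.Im l))%classic.

Lemma ccvg_unique u l l' : ccvg u l -> ccvg u l' -> l = l'.
Proof.
move=> [r1 i1] [r2 i2]; apply/eqP; rewrite eq_complex; apply/andP; split; apply/eqP.
  exact: (cvg_unique _ r1 r2).
exact: (cvg_unique _ i1 i2).
Qed.

Lemma ccvg_ext u u' l : u =1 u' -> ccvg u l -> ccvg u' l.
Proof. by move=> /funext ->. Qed.

Lemma ccvgZ a u l : ccvg u l -> ccvg (fun n => a * u n) (a * l).
Proof.
case: a => a b [hr hi]; split.
  have -> : complex.Re ((a +i* b) * l) = a * complex.Re l - b * complex.Im l.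
    by case: l {hr hi}.
  rewrite (_ : (fun n => _) = fun n => a * complex.Re (u n) - b * complex.Im (u n)).
    by apply: cvgB; apply: cvgMr.
  by apply/funext => n; case: (u n).
have -> : complex.Im ((a +i* b) * l) = a * complex.Im l + b * complex.Re l.
  by case: l {hr hi}.
rewrite (_ : (fun n => _) = fun n => a * complex.Im (u n) + b * complex.Re (u n)).
  by apply: cvgD; apply: cvgMr.
by apply/funext => n; case: (u n).
Qed.

Lemma ccvg_sum (I : Type) (r : seq I) (u : I -> nat -> R[i]) (l : I -> R[i]) :
  (forall i, ccvg (u i) (l i)) ->
  ccvg (fun n => \sum_(i <- r) u i n) (\sum_(i <- r) l i).
Proof.
move=> h; elim: r => [|i r [hr hi]].
  rewrite (_ : (fun _ => _) = fun=> 0); last by apply/funext => n; rewrite big_nil.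
  by rewrite big_nil; split; apply: cvg_cst.
rewrite (_ : (fun _ => _) = fun n => u i n + \sum_(j <- r) u j n); last first.
  by apply/funext => n; rewrite big_cons.
rewrite big_cons; split.
  rewrite raddfD (_ : (fun n => _) =
    fun n => complex.Re (u i n) + complex.Re (\sum_(j <- r) u j n)).
    exact: cvgD (h i).1 hr.
  by apply/funext => n; rewrite raddfD.
rewrite raddfD (_ : (fun n => _) =
  fun n => complex.Im (u i n) + complex.Im (\sum_(j <- r) u j n)).
  exact: cvgD (h i).2 hi.
by apply/funext => n; rewrite raddfD.
Qed.

Lemma exp_dominated_cvg (u : nat -> R) m :
  (forall k, `|u k| <= m ^+ k / k`!%:R) -> cvgn (series u).
Proof.
move=> hu; apply: normed_cvg; apply: series_le_cvg (is_cvg_series_exp_coeff m).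
- by move=> k; apply: normr_ge0.
- by move=> k; apply: le_trans (hu k).
exact: hu.
Qed.

(** Domination by an exponential series makes both [limn] genuine limits, not default values. *)
Lemma ccvg_series (u : nat -> R[i]) m :
  (forall k, `|u k| <= (m ^+ k / k`!%:R)%:C) ->
  ccvg (fun n => \sum_(k < n) u k)
    (limn (fun n => complex.Re (\sum_(k < n) u k))
     +i* limn (fun n => complex.Im (\sum_(k < n) u k))).
Proof.
move=> hu; split=> /=.
  rewrite (_ : (fun n => _) = series (fun k => complex.Re (u k))).
    apply: (@exp_dominated_cvg _ m) => k; rewrite -lecR.
    exact: le_trans (normc_ge_Re _) (hu k).
  by apply/funext => n; rewrite raddf_sum seriesEord.
rewrite (_ : (fun n => _) = series (fun k => complex.Im (u k))).
  apply: (@exp_dominated_cvg _ m) => k; rewrite -lecR -normrN -ReiNIm.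
  apply: le_trans (normc_ge_Re _) _; rewrite normrM.
  by rewrite [X in _ * X](_ : _ = 1) ?mulr1 // normc_def /= expr0n expr1n add0r sqrtr1.
by apply/funext => n; rewrite raddf_sum seriesEord.
Qed.

(** Written with the parities of the Taylor coefficients of cosine and sine. The induction goes by
    two because the square of - i x is real. *)
Lemma imag_expr x k : (0 -i* x) ^+ k =
  ((~~ odd k)%:R * (-1) ^+ k./2 * x ^+ k)
  -i* ((odd k)%:R * (-1) ^+ k.-1./2 * x ^+ k).
Proof.
elim/ltn_ind: k => -[|[|k]] IHk.
- by apply/eqP; rewrite eq_complex /=; apply/andP; split; apply/eqP; ring.
- by apply/eqP; rewrite eq_complex /=; apply/andP; split; apply/eqP; ring.
have -> : (0 -i* x) ^+ k.+2 = (- x ^+ 2)%:C * (0 -i* x) ^+ k.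
  rewrite !exprS mulrA; congr (_ * _); apply/eqP; rewrite eq_complex /= expr0.
  by apply/andP; split; apply/eqP; ring.
rewrite (IHk k (leqW (leqnn _))) /= ?negbK.
case: k {IHk} => [|k] /=; apply/eqP; rewrite eq_complex /=;
  apply/andP; split; apply/eqP; rewrite ?uphalfE /= ?exprS; try ring.
Qed.

Lemma ccvg_cis x : ccvg (fun n => \sum_(k < n) (k`!%:R)^-1 * (0 -i* x) ^+ k)
  (cos x -i* sin x).
Proof.
have term k : (k`!%:R)^-1 * (0 -i* x) ^+ k = cos_coeff x k -i* sin_coeff x k.
  rewrite imag_expr -(rmorph_nat (@real_complex_def R (Phant R))) -fmorphV /=.
  apply/eqP; rewrite eq_complex /=; apply/andP; split; apply/eqP.
    by rewrite cos_coeffE /=; ring.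
  by rewrite sin_coeffE /=; ring.
apply: (ccvg_ext (u := fun n => \sum_(k < n) (cos_coeff x k -i* sin_coeff x k))).
  by move=> n; apply: eq_bigr => k _; rewrite term.
split=> /=.
  rewrite (_ : (fun n => _) = series (cos_coeff x)).
    by rewrite cos.unlock; apply: is_cvg_series_cos_coeff.
  by apply/funext => n; rewrite raddf_sum seriesEord.
rewrite (_ : (fun n => _) = fun n => - series (sin_coeff x) n).
  by apply: cvgN; rewrite sin.unlock; apply: is_cvg_series_sin_coeff.
by apply/funext => n; rewrite raddf_sum seriesEord /= -sumrN.
Qed.

End ComplexLimits.

Section Fidelity.
Variables (R : realType) (T : finType) (d : nat).
Implicit Types (O : operator R T d) (psi : state R T d).

(** The sum of all absolute values bounds every row sum; a geometric bound is enough for the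
    exponential series. *)
Lemma expr_entry_le O k i j :
  `|(O ^+ k) i j| <= (\sum_i \sum_j `|O i j|) ^+ k.
Proof.
set m := \sum_i _; have m0 : 0 <= m by do 2 apply: sumr_ge0 => ? _.
elim: k i => [|k IHk] i.
  by rewrite !expr0 mxE; case: (_ == _); rewrite ?normr1 // normr0 ler01.
rewrite !exprS mxE; apply: le_trans (ler_norm_sum _ _ _) _.
apply: (@le_trans _ _ (\sum_l `|O i l| * m ^+ k)).
  by apply: ler_sum => l _; rewrite normrM ler_wpM2l.
rewrite -mulr_suml ler_wpM2r ?exprn_ge0 // /m [leRHS](bigD1 i) //= lerDl.
by do 2 apply: sumr_ge0 => ? _.
Qed.

Lemma ccvg_expmx O i j :
  ccvg (fun n => (\sum_(k < n) (k`!%:R)^-1 *: O ^+ k) i j) (expmx O i j).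
Proof.
have e n : (\sum_(k < n) (k`!%:R)^-1 *: O ^+ k) i j =
    \sum_(k < n) (k`!%:R)^-1 * (O ^+ k) i j.
  by rewrite summxE; apply: eq_bigr => k _; rewrite mxE.
apply: (ccvg_ext (fun n => esym (e n))).
have -> : expmx O i j =
    limn (fun n => complex.Re (\sum_(k < n) (k`!%:R)^-1 * (O ^+ k) i j))
    +i* limn (fun n => complex.Im (\sum_(k < n) (k`!%:R)^-1 * (O ^+ k) i j)).
  rewrite /expmx mxE.
  by congr (limn _ +i* limn _); apply/funext => n; rewrite e.
pose m := complex.Re (\sum_i \sum_j `|O i j|).
have hm : m%:C = \sum_i \sum_j `|O i j|.
  by apply: RRe_real; apply: ger0_real; do 2 apply: sumr_ge0 => ? _.
apply: (@ccvg_series _ (fun k => (k`!%:R)^-1 * (O ^+ k) i j) m) => k.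
rewrite normrM normfV normr_nat mulrC rmorphM /= fmorphV /= rmorphXn /= hm.
rewrite rmorph_nat ler_wpM2r ?invr_ge0 ?ler0n //.
exact: expr_entry_le.
Qed.

Lemma ccvg_expect O psi :
  ccvg (fun n => expect psi (\sum_(k < n) (k`!%:R)^-1 *: O ^+ k))
    (expect psi (expmx O)).
Proof.
have e (X : operator R T d) : expect psi X =
    \sum_i (psi i 0)^* * \sum_j psi j 0 * X i j.
  rewrite /expect innerE; apply: eq_bigr => i _; rewrite mxE; congr (_ * _).
  by apply: eq_bigr => j _; rewrite mulrC.
rewrite e; apply: (ccvg_ext (fun n => esym (e _))).
apply: ccvg_sum => i; apply: ccvgZ; apply: ccvg_sum => j; apply: ccvgZ.
exact: ccvg_expmx.
Qed.

Variables (O : operator R T d) (n : nat) (E : 'I_n -> R).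
Variables (v : 'I_n -> state R T d) (c : 'I_n -> R[i]).
Hypothesis hO : O \is hermsymmx.
Hypothesis E_inj : injective E.
Hypothesis hv : forall j, energy_eigenstate O (E j) (v j).
Let psi := \sum_j c j *: v j.

(** On [psi] the partial sums of the exponential act energy by energy and tend to exp(- i t E_j);
    uniqueness of limits identifies the result with that of [expmx]. *)
Lemma fidelity_spectral t : fidelity O psi t =
  Num.sqrt ((\sum_j weight (c j) * cos (t * E j)) ^+ 2
            + (\sum_j weight (c j) * sin (t * E j)) ^+ 2).
Proof.
pose l := \sum_j (weight (c j))%:C * (cos (t * E j) -i* sin (t * E j)).
have -> : fidelity O psi t = Normc.normc l.
  rewrite /fidelity; congr Normc.normc.
  apply: ccvg_unique (ccvg_expect _ _) _.
  pose u m j := \sum_(k < m) (k`!%:R)^-1 * (0 -i* (t * E j)) ^+ k.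
  apply: (ccvg_ext (u := fun m => \sum_j (weight (c j))%:C * u m j)).
    move=> m; rewrite -(inner_spectral c hO E_inj hv) /expect; congr inner.
    rewrite /psi mulmx_sumr; apply: eq_bigr => j _.
    rewrite -scalemxAr scalerA mulrC -scalerA; congr (_ *: _).
    rewrite mulmx_suml /u scaler_suml; apply: eq_bigr => k _.
    rewrite -scalemxAl (@eigenstate_expr _ _ _ _ (0 -i* (t * E j))) ?scalerA //.
    rewrite -scalemxAl (hv j).2 scalerA; congr (_ *: _).
    by apply/eqP; rewrite eq_complex /=; apply/andP; split; apply/eqP; ring.
  by apply: ccvg_sum => j; apply: ccvgZ; apply: ccvg_cis.
have -> : l = (\sum_j weight (c j) * cos (t * E j))
    -i* (\sum_j weight (c j) * sin (t * E j)).
  apply/eqP; rewrite eq_complex /l !raddf_sum /=.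
  apply/andP; split; apply/eqP; apply: eq_bigr => j _ /=; ring.
by rewrite /= sqrrN.
Qed.

(** With weights w_j = |c_j|^2 of sum 1, F(0) = 1 and 1 - F(tau)^2 = sum_{i,j} w_i w_j (1 - cos (tau
    (E_i - E_j))). All terms are nonnegative, so each vanishes. *)
Lemma perfect_revival (tau : R) : normalized psi ->
  fidelity O psi tau = fidelity O psi 0 ->
  forall i j, c i != 0 -> c j != 0 -> cos (tau * E i - tau * E j) = 1.
Proof.
move=> npsi; have w1 := sum_weight hO E_inj hv npsi.
rewrite !fidelity_spectral.
set a := \sum_j _ * cos (tau * _); set b := \sum_j _ * sin (tau * _).
have -> : \sum_j weight (c j) * cos (0 * E j) = 1.
  by rewrite -w1; apply: eq_bigr => j _; rewrite mul0r cos0 mulr1.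
have -> : \sum_j weight (c j) * sin (0 * E j) = 0.
  by apply: big1 => j _; rewrite mul0r sin0 mulr0.
rewrite expr0n expr1n addr0 sqrtr1 => e1.
have {}e1 : a ^+ 2 + b ^+ 2 = 1.
  by rewrite -[LHS]sqr_sqrtr ?addr_ge0 ?sqr_ge0 // e1 expr1n.
have w0 j : 0 <= weight (c j) by rewrite addr_ge0 ?sqr_ge0.
pose g i j := weight (c i) * weight (c j) * (1 - cos (tau * E i - tau * E j)).
have g0 i j : 0 <= g i j by rewrite !mulr_ge0 // subr_ge0 cos_le1.
have : \sum_i \sum_j g i j = 0.
  have -> : \sum_i \sum_j g i j = 1 - (a ^+ 2 + b ^+ 2); last by rewrite e1 subrr.
  have -> : 1 = (\sum_i weight (c i)) * (\sum_j weight (c j)) by rewrite w1 mulr1.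
  rewrite /a /b !expr2 !mulr_suml -big_split -sumrB; apply: eq_bigr => i _.
  rewrite /= !mulr_sumr -big_split -sumrB; apply: eq_bigr => j _.
  by rewrite /g cosB /=; ring.
move/eqP; rewrite psumr_eq0 => [/allP h|k _]; last exact: sumr_ge0.
move=> i j ci cj; have := h i (mem_index_enum _).
rewrite /= psumr_eq0 // => /allP /(_ j (mem_index_enum _)).
have wp k : c k != 0 -> weight (c k) != 0.
  move=> ck; rewrite -(inj_eq (@complexI R)) -weightE mulrC mul_conjC_eq0.
  exact: ck.
rewrite /= !mulf_eq0 (negbTE (wp _ ci)) (negbTE (wp _ cj)) /= subr_eq0.
by move/eqP.
Qed.

(** By cos x = 1 - 2 sin^2 (x / 2), and sin (x / 2) > 0 for 0 < x < 2 pi. *)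
Lemma cos_eq1_ge x : 0 < x -> cos x = 1 -> 2 * pi <= x :> R.
Proof.
move=> x0 cx; rewrite leNgt; apply/negP => x2.
have /sin_gt0_pi : 0 < x / 2 < pi by apply/andP; split; lra.
have := cosD (x / 2) (x / 2); have := cos2Dsin2 (x / 2).
rewrite -splitr cx => h1 h2 h3; nra.
Qed.

Lemma energy_spacing (tau : R) : 0 < tau -> normalized psi ->
  fidelity O psi tau = fidelity O psi 0 ->
  forall i j, c i != 0 -> c j != 0 -> E i < E j -> 2 * pi <= tau * (E j - E i).
Proof.
move=> t0 npsi hrev i j ci cj Eij; have cij := perfect_revival npsi hrev cj ci.
have x0 : 0 < tau * E j - tau * E i by rewrite subr_gt0 ltr_pM2l.
rewrite mulrBr.
exact: cos_eq1_ge x0 cij.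
Qed.

(** Pigeonhole: the integer parts of tau E_j / (2 pi) are distinct for the energies that occur, and
    at most that of B tau / (2 pi). The predecessor counts the gaps. *)
Lemma card_energies (tau B : R) : 0 < tau -> normalized psi ->
  fidelity O psi tau = fidelity O psi 0 ->
  (forall j, 0 <= E j <= B) ->
  (#|[set j | c j != 0]|.-1)%:R * (2 * pi) <= B * tau.
Proof.
move=> t0 npsi hrev hB.
have spacing := energy_spacing t0 npsi hrev.
(* A normalized [psi] forces [n] to be positive, so some energy lies between 0 and [B]. *)
have B0 : 0 <= B.
  case: n E v c hB @psi npsi {hrev spacing} => [|m] E' v' c' hB' psi'.
    rewrite /psi' big_ord0 /normalized inner0r => /eqP.
    by rewrite eq_sym oner_eq0.
  by move=> _; have /andP[h1 h2] := hB' ord0; apply: le_trans h2.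
clear npsi hrev; have : 0 < 2 * pi :> R by rewrite mulr_gt0 ?pi_gt0 ?ltr0n.
move: (2 * pi) spacing => P spacing P0.
have [->|/set0Pn[j0 hj0]] := eqVneq [set j | c j != 0] finset.set0.
  by rewrite cards0 mul0r mulr_ge0 // ltW.
pose f j := Num.trunc (tau * E j / P).
have E0 j : 0 <= E j by have /andP[] := hB j.
have fr0 j : 0 <= tau * E j / P.
  by rewrite divr_ge0 ?mulr_ge0 ?(ltW t0) ?(ltW P0).
pose m := Num.trunc (B * tau / P).
have fm j : (f j < m.+1)%N.
  have le_fm : tau * E j / P <= B * tau / P.
    have /andP[_ le_EB] := hB j.
    by rewrite ler_wpM2r ?invr_ge0 ?(ltW P0) // mulrC ler_wpM2r ?(ltW t0).
  by rewrite ltnS; have := le_truncn le_fm.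
have f_inj : {in [set j | c j != 0] &, injective (fun j => Ordinal (fm j))}.
  suff lt_f i j : c i != 0 -> c j != 0 -> E i < E j -> f i != f j.
    move=> i j; rewrite !inE => ci cj [] /eqP eqf; apply: E_inj.
    apply/eqP; rewrite eq_le !leNgt; apply/andP; split; apply/negP => lt_E.
      by have := lt_f _ _ cj ci lt_E; rewrite eq_sym eqf.
    by have := lt_f _ _ ci cj lt_E; rewrite eqf.
  move=> ci cj lt_E; apply/negP => /eqP eqf.
  have := spacing _ _ ci cj lt_E.
  have /andP[_] := truncn_itv (fr0 j); have /andP[+ _] := truncn_itv (fr0 i).
  rewrite -/(f i) -/(f j) eqf ler_pdivlMr // ltr_pdivrMr //.
  rewrite -natr1; lra.
have hcard : (#|[set j | (c j != 0)%R]| <= m.+1)%N.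
  by rewrite -(card_in_imset f_inj) -[X in (_ <= X)%N]card_ord max_card.
have le_m : (#|[set j | c j != 0]|.-1)%:R <= m%:R :> R.
  by rewrite ler_nat -ltnS (leq_trans _ hcard) // prednK // lt0n cards_eq0; apply/set0Pn; exists j0.
rewrite -ler_pdivlMr //; apply: le_trans le_m _.
rewrite /m truncn_le divr_ge0 ?mulr_ge0 //; exact: ltW.
Qed.

(* Lagrange interpolation at the energies that occur in psi. *)
Lemma eigenstate_krylov i : c i != 0 ->
  exists a : nat -> R[i], v i =
    \sum_(k < #|[set j | c j != 0]|.-1.+1) a k *: (O ^+ k *m psi).
Proof.
move=> ci; set J := [set j | c j != 0].
have iJ : i \in J by rewrite inE.
have J0 : (0 < #|J|)%N by rewrite (cardD1 i) iJ.
pose rs := [seq (E j)%:C | j <- enum (J :\ i)].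
(* [p] vanishes at the occurring energies other than E_i, so p(O) psi = c_i p(E_i) v_i; the nonzero
   factor is divided out below. *)
pose p := \prod_(a <- rs) ('X - a%:P).
have size_p : size p = #|J|.-1.+1.
  rewrite (size_prod_XsubC rs id) size_map -cardE prednK //.
  by rewrite (cardsD1 i J) iJ.
have root_p j : root p (E j)%:C = (j \in J :\ i).
  rewrite root_prod_XsubC; apply/mapP/idP => [[k]|hj].
    by rewrite mem_enum => hk [] /E_inj ->.
  by exists j; rewrite ?mem_enum.
have nz : c i * p.[(E i)%:C] != 0.
  by rewrite mulf_neq0 //; have := root_p i; rewrite /root !inE eqxx /= => ->.
exists (fun k => p`_k / (c i * p.[(E i)%:C])).
under eq_bigr => k _ do rewrite mulrC -scalerA.
rewrite -scaler_sumr.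
suff -> : \sum_(k < #|J|.-1.+1) p`_k *: (O ^+ k *m psi) =
    (c i * p.[(E i)%:C]) *: v i by rewrite scalerA mulVf // scale1r.
have -> : \sum_(k < #|J|.-1.+1) p`_k *: (O ^+ k *m psi) =
    \sum_j (c j * p.[(E j)%:C]) *: v j.
  under eq_bigr => k _ do rewrite /psi mulmx_sumr scaler_sumr.
  rewrite exchange_big; apply: eq_bigr => j _ /=.
  rewrite horner_coef size_p mulr_sumr scaler_suml; apply: eq_bigr => k _.
  rewrite -scalemxAr (eigenstate_expr _ (hv j).2) !scalerA; congr (_ *: _).
  by rewrite [LHS]mulrAC mulrC mulrA.
rewrite (bigD1 i) //= big1 ?addr0 // => j ne.
have [->|cj] := eqVneq (c j) 0; first by rewrite mul0r scale0r.
have /rootP -> : root p (E j)%:C by rewrite root_p !inE ne.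
by rewrite mulr0 scale0r.
Qed.

End Fidelity.

(** * Krylov vectors across a sequence of cuts *)

Section CutSequence.
Variables (R : realType) (T : finType) (d : nat).
Variables (hx : T -> operator R T d) (b M : nat) (cuts : nat -> {set T}).
Hypothesis hx_local : forall x, exists2 S : {set T},
  (#|S| <= b)%N & supported_on S (hx x).
Hypothesis cuts_mono : forall q' q, (q' < q < M)%N -> cuts q' \subset cuts q.
Hypothesis cuts_disj : forall q' q x, (q' < M)%N -> (q < M)%N ->
  x \in boundary_terms hx (cuts q') -> x \in boundary_terms hx (cuts q) -> q' = q.

Let outside q x := op_support (hx x) :&: ~: cuts q != finset.set0.
Let meets q x := op_support (hx x) :&: cuts q != finset.set0.
Let bd q x := x \in boundary_terms hx (cuts q).
(** A term with empty support counts as left, which makes the three kinds exclusive and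
    exhaustive. *)
Let lt q x := ~~ outside q x.
Let rt q x := outside q x && ~~ meets q x.

Let kindP q x : (lt q x + rt q x + bd q x = 1)%N.
Proof.
by rewrite /lt /rt /bd inE -/(meets q x) -/(outside q x); do 2 case: (_ q x).
Qed.

(** A term across an earlier cut meets [cuts q] by monotonicity; reaching outside it as well, it
    would cross both cuts. *)
Let bd_lt q' q x : (q' < q < M)%N -> bd q' x -> lt q x.
Proof.
move=> lt_q bx; case/andP: (lt_q) => qq qM; apply/negP => out.
have: bd q x.
  rewrite /bd inE -/(outside q x) out andbT.
  move: bx; rewrite /bd inE => /andP[/set0Pn[y]].
  rewrite inE => /andP[y1 y2] _; apply/set0Pn; exists y.
  by rewrite inE y1 (fintype.subsetP (cuts_mono lt_q)).
move/(cuts_disj (ltn_trans qq qM) qM bx) => e.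
by rewrite e ltnn in qq.
Qed.

(** The boundaries are disjoint, so each letter is counted at most once. *)
Lemma count_boundary_le w :
  (\sum_(q < M) count (fun x => x \in boundary_terms hx (cuts q)) w <= size w)%N.
Proof.
rewrite -[X in (X <= _)%N]/(\sum_(q < M) count (bd q) w)%N.
elim: w => [|x w IHw] /=; first by rewrite big1.
rewrite big_split /= -add1n leq_add //.
case: (pickP (fun q : 'I_M => bd q x)) => [q bq|no]; last first.
  by rewrite big1 // => q _; have := no q => /= ->.
rewrite (bigD1 q) //= bq big1 // => k; case bk: (bd k x) => // /eqP[].
by apply: val_inj; apply: (cuts_disj (ltn_ord k) (ltn_ord q) bk bq).
Qed.

(** Pigeonhole: more than [c] crossings at each of the [M] cuts would need [M * c.+1] letters. *)
Lemma sparse_cut c w : (size w < M * c.+1)%N ->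
  exists2 q, (q < M)%N & (count (fun x => x \in boundary_terms hx (cuts q)) w <= c)%N.
Proof.
move=> sz; case: (pickP (fun q : 'I_M => count (bd q) w <= c)%N) => [q hq|no].
  by exists q.
have : (\sum_(q < M) c.+1 <= \sum_(q < M) count (bd q) w)%N.
  by apply: leq_sum => q _; have := no q => /= /negbT; rewrite -ltnNge.
rewrite sum_nat_const card_ord => h; have := leq_trans h (count_boundary_le w).
by rewrite leqNgt sz.
Qed.

(** [krylov_rank] with [e = d ^ (2 * b)], from [unfold_boundary], and [dl = d ^ w], from
    [unfold_change]. *)
Lemma krylov_unfold_rank (f0 : config T d) (x0 : T) psi A K c w (a : nat -> R[i]) :
  (forall u, (size u <= K)%N ->
     exists2 q, (q < M)%N & (count (fun x => x \in boundary_terms hx (cuts q)) u <= c)%N) ->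
  (forall q, (q < M)%N -> #|(A :\: cuts q) :|: (cuts q :\: A)| <= w)%N ->
  (\rank (unfold A (\sum_(k < K.+1) a k *: (hamiltonian hx ^+ k *m psi))%R)
    <= K.+1 * (M * ((d ^ w) ^ 2 *
         (c.+1 * (K.+1 * (K.+1 ^ 2 * (#|T| * d ^ (2 * b))) ^ c)
          * \rank (unfold A psi)))))%N.
Proof.
move=> cover near.
have d0 : (0 < d)%N by case: (f0 x0) => i; apply: leq_ltn_trans.
have [B hB] : {B : nat -> T -> seq (operator R T d * operator R T d) &
    forall q x, (size (B q x) <= d ^ (2 * b))%N /\ forall phi,
    unfold (cuts q) (hx x *m phi) = \sum_(t <- B q x) t.1 *m unfold (cuts q) phi *m t.2}.
  suff h q x : {s : seq (operator R T d * operator R T d) |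
      (size s <= d ^ (2 * b))%N /\ forall phi,
      unfold (cuts q) (hx x *m phi) = \sum_(t <- s) t.1 *m unfold (cuts q) phi *m t.2}.
    by exists (fun q x => sval (h q x)) => q x; apply: (svalP (h q x)).
  apply: cid; have [S Sb /supported_acts_on hS] := hx_local x.
  have [s [sz hs]] := unfold_boundary f0 (cuts q) hS.
  by exists s; split=> //; rewrite sz leq_pexp2l // leq_mul.
have e1 k : hamiltonian hx ^+ k *m psi =
    iter k (fun u => \sum_x hx x *m u) psi.
  elim: k => [|k IHk]; first by rewrite expr0 mul1mx.
  by rewrite exprS -mulmxA IHk /= /hamiltonian mulmx_suml.
under eq_bigr => k _ do rewrite e1.
pose unf q : {linear state R T d -> 'M[R[i]]_#|config T d|} := unfold (cuts q).
apply: (@krylov_rank _ T bd lt M c bd_lt (state R T d) (fun x u => hx x *m u)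
  _ _ unf rt hx (fun x => (hx x)^T) (d ^ (2 * b)) B).
- by move=> x a' u v; rewrite mulmxDr scalemxAr.
- exact: kindP.
- move=> q x u; rewrite /lt negbK => /eqP out; apply: unfold_left.
  by rewrite -[cuts q]finset.setCK; apply: acts_on_op_support.
- move=> q x u /andP[_]; rewrite negbK => /eqP out; apply: unfold_right.
  exact: acts_on_op_support.
- move=> q x u _; exact: (hB q x).2.
- move=> q x; exact: (hB q x).1.
- by rewrite muln_gt0 expn_gt0 d0 andbT; apply/card_gt0P; exists x0.
- exact: cover.
- move=> q u qM; apply: leq_trans (unfold_change f0 A (cuts q) u) _.
  by rewrite leq_mul // leq_pexp2l // near.
move=> q u qM; apply: leq_trans (unfold_change f0 (cuts q) A u) _.
by rewrite leq_mul // leq_pexp2l // finset.setUC near.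
Qed.

End CutSequence.

(** * Numerical estimates *)

Section Numerics.
Variable R : realType.

Lemma sin_le_id (x : R) : 0 <= x -> sin x <= x.
Proof.
move=> x0; have csin : {within `[0, x], continuous sin}%classic.
  by apply: continuous_subspaceT => y; apply: continuous_sin.
have [y _] := MVT_segment x0 (fun y _ => is_derive_sin y) csin.
rewrite sin0 !subr0 => ->; rewrite ler_piMl //; exact: cos_le1.
Qed.

(** From sin^2 (pi / 4) = 1 / 2 and sin (pi / 4) <= pi / 4. *)
Lemma pi_sqr_ge8 : 8 <= pi ^+ 2 :> R.
Proof.
have p0 := pi_gt0 R.
have e : cos (pi / 4 + pi / 4) = 0 :> R.
  by rewrite -(cos_pihalf R); congr cos; field.
have := sin_le_id (ltW (divr_gt0 p0 (ltr0n R 4))).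
have : 0 <= sin (pi / 4) :> R.
  by apply: sin_ge0_pi; apply/andP; split; lra.
move: (cos2Dsin2 (pi / 4 : R)) e; rewrite cosD; nra.
Qed.

(** Makes 7 sqrt(pi) at least 21 / 2 in the final bound; pi >= 2 would not suffice for this. *)
Lemma sqrt_pi_ge : 3 / 2 <= Num.sqrt pi :> R.
Proof.
rewrite -[leLHS]ger0_norm ?divr_ge0 // -sqrtr_sqr ler_wsqrtr //.
have := pi_gt0 R; have := pi_sqr_ge8; nra.
Qed.

(** [Q] stands for h N^2 tau, and [Num.sqrt pi * (m * a)%:R] for the square root in the final bound.
    The coefficients of ln Q and of b ln d are each compared with 21 m a / 2. *)
Lemma ln_rank_bound (N m a K c M w d b rk rho : nat) (Q chi : R) :
  (0 < N)%N -> (0 < m)%N -> (0 < a)%N -> (0 < d)%N -> (0 < M)%N ->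
  Q = pi * (N * (m ^ 2 * a))%:R -> 1 <= chi ->
  (2 * K <= m ^ 2 * a)%N -> (c <= K)%N -> (4 * c <= m * a)%N ->
  (M <= 3 * m)%N -> (4 * (w + b * c) <= 21 * (b * (m * a)))%N ->
  rho%:R <= chi ^+ a ->
  (rk <= K.+1 * (M * ((d ^ w) ^ 2 *
     (c.+1 * (K.+1 * (K.+1 ^ 2 * (N * d ^ (2 * b))) ^ c) * rho))))%N ->
  ln rk%:R <= 7 * (Num.sqrt pi * (m * a)%:R) * ln (Q * d%:R ^+ b)
              + a%:R * ln chi.
Proof.
move=> N0 m0 a0 d0 M0 hQ chi1 hK hc hca hM hw hrho hrk.
have p2 := pi_ge2 R.
have nat1 k : (0 < k)%N -> 1 <= k%:R :> R by rewrite ler1n.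
have chi0 : 0 < chi by apply: lt_le_trans chi1.
have le_natQ k : (k <= 2 * (N * (m ^ 2 * a)))%N -> k%:R <= Q.
  move=> hk; rewrite hQ; apply: (@le_trans _ _ (2 * (N * (m ^ 2 * a)))%:R).
    by rewrite ler_nat.
  by rewrite natrM ler_wpM2r.
have ma0 : (0 < m ^ 2 * a)%N by rewrite muln_gt0 expn_gt0 m0.
have Q1 : 1 <= Q by apply: (le_natQ 1%N); nia.
have Q0 : 0 < Q by apply: lt_le_trans Q1.
have lnle k : (0 < k)%N -> k%:R <= Q -> ln k%:R <= ln Q :> R.
  by move=> k0 kQ; rewrite ler_ln ?posrE ?ltr0n.
have lK : ln K.+1%:R <= ln Q :> R by apply: lnle => //; apply: le_natQ; nia.
have lc : ln c.+1%:R <= ln Q :> R by apply: lnle => //; apply: le_natQ; nia.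
have lN : ln N%:R <= ln Q :> R by apply: lnle => //; apply: le_natQ; nia.
(* [M] may exceed what [le_natQ] covers, hence M <= 3 m <= (2 m)^2 <= Q^2. *)
have lM : ln M%:R <= 2 * ln Q :> R.
  have -> : 2 * ln Q = ln (Q ^+ 2) by rewrite lnXn // mulr_natl.
  rewrite ler_ln ?posrE ?ltr0n ?exprn_gt0 //.
  apply: (@le_trans _ _ ((2 * m) ^ 2)%:R); first by rewrite ler_nat; nia.
  by rewrite natrX lerXn2r ?nnegrE ?ler0n ?(ltW Q0) // le_natQ //; nia.
have ld : 0 <= ln d%:R :> R by rewrite ln_ge0 // nat1.
have lQ : 0 <= ln Q by rewrite ln_ge0.
have lchi : 0 <= ln chi by rewrite ln_ge0.
(* A vanishing rank gives [ln 0 = 0], for which the right-hand side has to be nonnegative. *)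
have rhs0 : 0 <= 7 * (Num.sqrt pi * (m * a)%:R) * ln (Q * d%:R ^+ b)
              + a%:R * ln chi.
  rewrite addr_ge0 ?mulr_ge0 ?sqrtr_ge0 ?ler0n // ln_ge0 //.
  by rewrite mulr_ege1 // exprn_ege1 // nat1.
have [->|rk0] := posnP rk; first by rewrite ln0.
have rho0 : (0 < rho)%N.
  by rewrite lt0n; apply: contraTneq hrk => ->; rewrite !muln0 -ltnNge.
set X := (K.+1 * _)%N in hrk.
(* The power [c] gives 3 c; the 5 comes from two factors [K.+1], one [c.+1], and [M] counted
   twice. *)
have lX : ln X%:R <= (3 * c%:R + 5) * ln Q + 2 * (w%:R + b%:R * c%:R) * ln d%:R
    + a%:R * ln chi.
  have pn k : (0 < k)%N -> (k%:R : R) \is Num.pos by rewrite posrE ltr0n.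
  have lnMn k k' : (0 < k)%N -> (0 < k')%N ->
      ln (k * k')%:R = ln k%:R + ln k'%:R :> R.
    by move=> k0 k'0; rewrite natrM lnM // pn.
  have lnXn' k e : (0 < k)%N -> ln (k ^ e)%:R = e%:R * ln k%:R :> R.
    by move=> k0; rewrite natrX lnXn ?ltr0n // mulr_natl.
  have pos := (muln_gt0, expn_gt0, d0, N0, M0, rho0, orbT).
  rewrite /X !(lnMn, lnXn') ?pos //.
  have lrho : ln rho%:R <= a%:R * ln chi :> R.
    by rewrite mulr_natl -lnXn // ler_ln ?pn // posrE exprn_gt0.
  have c0 : 0 <= c%:R :> R by [].
  rewrite natrM.
  have h1 := ler_wpM2l c0 lK; have h2 := ler_wpM2l c0 lN.
  lra.
have lnQd : ln (Q * d%:R ^+ b) = ln Q + b%:R * ln d%:R.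
  by rewrite lnM ?posrE ?exprn_gt0 ?ltr0n // lnXn ?ltr0n // mulr_natl.
have le_rk : ln rk%:R <= ln X%:R :> R.
  by rewrite ler_ln ?posrE ?ltr0n // ?ler_nat // (leq_trans rk0).
apply: le_trans le_rk _; apply: le_trans lX _; rewrite lnQd lerD2r.
have ma1 : 1 <= (m * a)%:R :> R by rewrite nat1 // muln_gt0 m0.
have hs : 21 / 2 * (m * a)%:R <= 7 * (Num.sqrt pi * (m * a)%:R) :> R.
  have := sqrt_pi_ge; have : 0 <= (m * a)%:R :> R by []; nra.
have hca' : 4 * c%:R <= (m * a)%:R :> R by rewrite -natrM ler_nat.
have hw' : 2 * (w%:R + b%:R * c%:R) <= 21 / 2 * (m * a)%:R * b%:R :> R.
  suff : (4 * (w + b * c))%:R <= (21 * (b * (m * a)))%:R :> R.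
    by rewrite !(natrM, natrD); lra.
  by rewrite ler_nat.
apply: (@le_trans _ _ (21 / 2 * (m * a)%:R * (ln Q + b%:R * ln d%:R))); last first.
  by rewrite ler_wpM2r // addr_ge0 // mulr_ge0.
rewrite [leRHS]mulrDr lerD //; first by rewrite ler_wpM2r //; lra.
by rewrite mulrA ler_wpM2r.
Qed.

End Numerics.

(** * The regular bipartition and the conclusion *)

Lemma area_gt0_site (D : nat) (L : lattice D) (A : {set site L}) :
  (0 < area (@neighbour D L) A)%N -> exists x : site L, True.
Proof. by case/card_gt0P => -[x y] _; exists x. Qed.

Lemma normalized_config (R : realType) (T : finType) (d : nat)
    (psi : state R T d) : normalized psi -> exists f : config T d, True.
Proof.
move=> npsi; case: (pickP (fun _ : config T d => true)) => [f _|no].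
  by exists f.
move/eqP: npsi; rewrite innerE big1 1?eq_sym ?oner_eq0 // => k _.
by have := no (enum_val k).
Qed.

Section RegularCut.
Variables (R : realType) (T : finType) (nn : rel T) (d : nat).
Variables (hx : T -> operator R T d) (m : nat) (A : {set T}) (As : int -> {set T}).
Hypothesis As0 : As 0 = A.
Hypothesis As_mono : forall q : int, - m%:Z <= q < m%:Z -> As q \subset As (q + 1).

(** The cuts - m to m are renumbered from 0, so that [A] becomes number [m]. *)
Let cuts (q : nat) := As (q%:Z - m%:Z).

Lemma cuts_mono q' q : (q' <= q < 2 * m + 1)%N -> cuts q' \subset cuts q.
Proof.
elim: q => [|q IHq]; first by rewrite leqn0 => /andP[/eqP -> _].
case/andP; rewrite leq_eqVlt => /orP[/eqP -> //|le_q lt_q].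
apply: fintype.subset_trans (IHq _) _; first by lia.
have -> : cuts q.+1 = As ((q%:Z - m%:Z) + 1) by congr As; lia.
by apply: As_mono; lia.
Qed.

(** Cuts up to number [m] lie between the innermost one and [A], later ones between [A] and the
    outermost. So one of the two differences is empty and the other lies in a collar. *)
Lemma cuts_near w q :
  (#|As m%:Z :\: A| <= w)%N -> (#|A :\: As (- m%:Z)| <= w)%N ->
  (q < 2 * m + 1)%N -> (#|(A :\: cuts q) :|: (cuts q :\: A)| <= w)%N.
Proof.
move=> hi lo hq.
have cm : cuts m = A by rewrite /cuts subrr.
have c0 : cuts 0 = As (- m%:Z) by rewrite /cuts add0r.
have c2 : cuts (2 * m) = As m%:Z by congr As; lia.
have [le_q|lt_q] := leqP q m.
  have : cuts q \subset A by rewrite -cm cuts_mono //; lia.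
  rewrite -finset.setD_eq0 => /eqP ->; rewrite finset.setU0.
  by apply: leq_trans lo; rewrite subset_leq_card // finset.setDS // -c0 cuts_mono.
have : A \subset cuts q by rewrite -cm cuts_mono //; lia.
rewrite -finset.setD_eq0 => /eqP ->; rewrite finset.set0U.
apply: leq_trans hi; rewrite subset_leq_card // finset.setSD // -c2 cuts_mono //.
by lia.
Qed.

End RegularCut.

(** A term across a cut acts on a site of each side, hence on at least two sites. *)
Lemma boundary_terms0 (R : realType) (T : finType) (d : nat) (f0 : config T d)
    (hx : T -> operator R T d) (x : T) (S A : {set T}) :
  (#|S| <= 1)%N -> supported_on S (hx x) -> x \notin boundary_terms hx A.
Proof.
move=> S1 /(sub_op_support f0) /fintype.subsetP sS; rewrite inE.
apply/negP => /andP[/set0Pn[y]]; rewrite finset.inE => /andP[/sS yS yA].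
case/set0Pn => z; rewrite !finset.inE => /andP[zsupp zA].
have zS : z \in S by apply: sS; rewrite finset.inE.
have : (#|[set y; z]| <= #|S|)%N.
  rewrite subset_leq_card //; apply/fintype.subsetP => t.
  by rewrite !finset.inE => /orP[] /eqP ->.
rewrite cards2; case: eqP => [e|_]; first by rewrite -e yA in zA.
by move=> h2; have := leq_trans h2 S1.
Qed.

(** As m > 0 the radicand is positive, which excludes a = 0, a quotient by 0 being 0. *)
Lemma sqrt_quotient (R : rcfType) (x p : R) (m a : nat) :
  0 < p -> (0 < m)%N -> m%:R = Num.sqrt (x / (p * a%:R)) ->
  (0 < a)%N /\ x = p * (m ^ 2 * a)%:R.
Proof.
move=> p0 m0 hm.
have y0 : 0 < x / (p * a%:R) by rewrite -sqrtr_gt0 -hm ltr0n.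
have a0 : (0 < a)%N.
  by rewrite lt0n; apply: contraTneq y0 => ->; rewrite mulr0 invr0 mulr0 ltxx.
split=> //; have pa0 : p * a%:R != 0 by rewrite mulf_neq0 ?gt_eqF ?ltr0n.
by rewrite natrM natrX hm sqr_sqrtr ?(ltW y0) // mulrCA divfK.
Qed.

Lemma leq_of_scaled (R : realFieldType) (p : R) (x y : nat) :
  0 < p -> x%:R * (2 * p) <= p * y%:R -> (2 * x <= y)%N.
Proof.
by move=> p0; rewrite -(ler_nat R) natrM mulrA [leLHS]mulrC ler_pM2l // mulrC.
Qed.

Theorem theorem3 (R : realType)
    (* constants, quantified before the size of the system *)
    (D d b : nat) (h chi C xi s : R)
    (hD : (0 < D)%N) (hchi : 1 <= chi)
    (hC : 0 < C) (hxi : 0 < xi) (hs : 0 < s)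
    (* the local Hamiltonian *)
    (L : lattice D) (hL : lattice_connected L)
    (hx : site L -> operator R (site L) d)
    (hloc : forall x, local_term (@neighbour D L) b h (hx x))
    (hE0 : ground_energy (hamiltonian hx) 0)
    (* the initial state *)
    (psi : state R (site L) d) (hpsi : normalized psi)
    (hLE : low_entanglement (@neighbour D L) chi psi)
    (hSR : decaying_correlations (@neighbour D L) C xi psi /\
           energy_spread (hamiltonian hx) psi
             = s * Num.sqrt (#|site L|)%:R)
    (* perfect revival *)
    (tau : R) (htau : 0 < tau)
    (hrev : fidelity (hamiltonian hx) psi tau
              = fidelity (hamiltonian hx) psi 0)
    (* decomposition into eigenstates, each energy appearing only once *)
    (n : nat) (E : 'I_n -> R) (v : 'I_n -> state R (site L) d)
    (c : 'I_n -> R[i])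
    (hE : injective E)
    (hv : forall j, energy_eigenstate (hamiltonian hx) (E j) (v j))
    (hdec : psi = \sum_j c j *: v j)
    (i : 'I_n) (hci : c i != 0)
    (* the region *)
    (A : {set site L}) (m : nat) (hm : (0 < m)%N)
    (hmA : m%:R = Num.sqrt (h * (#|site L|)%:R * tau
                              / (pi * (area (@neighbour D L) A)%:R)))
    (hreg : cut_regular (@neighbour D L) hx m A) :
  renyi0 (reduced A (projector (v i)))
    <= 7 * Num.sqrt (h * (#|site L|)%:R * tau
                       * (area (@neighbour D L) A)%:R)
         * ln (h * (#|site L|)%:R ^+ 2 * tau * d%:R ^+ b)
       + (area (@neighbour D L) A)%:R * ln chi.
Proof.
have [[herm_hx norm_hx] loc_hx] : ((forall x, hx x \is hermsymmx) /\
    (forall x, opnorm (hx x) <= h)) /\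
    (forall x, exists2 S : {set site L}, (#|S| <= b)%N & supported_on S (hx x)).
  split; first by split=> x; have [] := hloc x.
  by move=> x; have [_ _ [S [_ Sb hS]]] := hloc x; exists S.
have [f0 _] := normalized_config hpsi.
set a := area _ _ in hmA *; set N := #|site L|.
(* The choice of [m] becomes h N tau = pi m^2 a, with a > 0. *)
have [a0 hNt] := sqrt_quotient (pi_gt0 R) hm hmA.
have [x0 _] := area_gt0_site a0.
have N0 : (0 < N)%N by apply/card_gt0P; exists x0.
have d0 : (0 < d)%N by case: (f0 x0) => k; apply: leq_ltn_trans.
have hH := hermitian_hamiltonian herm_hx.
have energies j : 0 <= E j <= h * N%:R.
  rewrite (eigenstate_energy_ge0 hH hE0 (hv j)) /=.
  exact: eigenstate_energy_le norm_hx (hv j).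
pose K := #|[set j | c j != 0]|.-1.
(* [card_energies] gives K (2 pi) <= h N tau = pi m^2 a. *)
have hK : (2 * K <= m ^ 2 * a)%N.
  rewrite hdec in hpsi hrev.
  have := card_energies hH hE hv htau hpsi hrev energies.
  by rewrite hNt; apply: leq_of_scaled (pi_gt0 R).
have [al hal] := eigenstate_krylov hE hv hci; rewrite -hdec -/K in hal.
rewrite /renyi0 (rank_reduced f0).
have hrho : (\rank (unfold A psi))%:R <= chi ^+ a.
  by rewrite -(rank_reduced f0); apply: hLE.
clear hpsi hLE hSR hrev hdec hci hmA hE0 hloc hv norm_hx energies hH herm_hx.
have -> : h * N%:R ^+ 2 * tau = pi * (N * (m ^ 2 * a))%:R.
  by rewrite natrM expr2 [RHS]mulrCA -hNt; ring.
have -> : Num.sqrt (h * N%:R * tau * a%:R) = Num.sqrt pi * (m * a)%:R.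
  rewrite hNt -mulrA sqrtrM ?pi_ge0 // -natrM -mulnA mulnn -expnMn natrX.
  by rewrite sqrtr_sqr ger0_norm.
(* Common to the two choices of cuts below: [M] cuts, at most [l] crossings, and at most [w] sites
   by which a cut differs from [A]. *)
have bound (M l w : nat) (cuts : nat -> {set site L}) : (0 < M)%N ->
    (forall q' q, (q' < q < M)%N -> cuts q' \subset cuts q) ->
    (forall q' q x, (q' < M)%N -> (q < M)%N ->
      x \in boundary_terms hx (cuts q') -> x \in boundary_terms hx (cuts q) ->
      q' = q) ->
    (forall u, (size u <= K)%N -> exists2 q, (q < M)%N &
      (count (fun x => x \in boundary_terms hx (cuts q)) u <= l)%N) ->
    (forall q, (q < M)%N -> #|(A :\: cuts q) :|: (cuts q :\: A)| <= w)%N ->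
    (l <= K)%N -> (4 * l <= m * a)%N -> (M <= 3 * m)%N ->
    (4 * (w + b * l) <= 21 * (b * (m * a)))%N ->
    ln (\rank (unfold A (v i)))%:R <=
      7 * (Num.sqrt pi * (m * a)%:R) * ln (pi * (N * (m ^ 2 * a))%:R * d%:R ^+ b)
      + a%:R * ln chi.
  move=> M0 mono disj cover near lK hl hM hw.
  apply: (ln_rank_bound N0 hm a0 d0 M0 erefl hchi hK lK hl hM hw hrho).
  by rewrite hal; apply: (krylov_unfold_rank loc_hx mono disj f0 x0).
(* The factor d ^ (20 m a) paid for moving the cut is only absorbed for b >= 2;
   for b <= 1 no term crosses a cut, and A itself is used. *)
have [b1|b2] := leqP b 1.
  have no_bd x : x \notin boundary_terms hx A.
    have [S Sb hS] := loc_hx x.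
    exact: (boundary_terms0 f0 A (leq_trans Sb b1) hS).
  apply: (bound 1%N 0%N 0%N (fun=> A)) => //.
  - by move=> q' q x _ _ xA; have := no_bd x; rewrite xA.
  - move=> u _; exists 0%N => //; rewrite leqn0 eqn0Ngt -has_count.
    by apply/hasPn => x _; apply: no_bd.
  - by move=> q _; rewrite finset.setDv finset.setU0 cards0.
  - by rewrite muln_gt0.
  by rewrite !muln0.
have [As [As0 _ As_mono [As_hi As_lo] As_disj]] := hreg.
have M0 : (0 < 2 * m + 1)%N by rewrite addn1.
pose l := (K %/ (2 * m + 1))%N.
have cM : (l * (2 * m + 1) <= K)%N by apply: leq_trunc_div.
(* 4 l m <= 2 l (2 m + 1) <= 2 K <= m^2 a, and m cancels. *)
have hl : (4 * l <= m * a)%N.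
  have : (m * (4 * l) <= m * (m * a))%N by nia.
  by rewrite leq_pmul2l.
have disj q' q x : (q' < 2 * m + 1)%N -> (q < 2 * m + 1)%N ->
    x \in boundary_terms hx (As (q'%:Z - m%:Z)) ->
    x \in boundary_terms hx (As (q%:Z - m%:Z)) -> q' = q.
  move=> hq' hq bq' bq.
  have r q0 : (q0 < 2 * m + 1)%N -> - m%:Z <= q0%:Z - m%:Z <= m%:Z by lia.
  by have := As_disj x _ _ (r _ hq') (r _ hq) bq' bq; lia.
have mono q' q : (q' < q < 2 * m + 1)%N ->
    As (q'%:Z - m%:Z) \subset As (q%:Z - m%:Z).
  by case/andP=> lt_q lt_M; apply: (cuts_mono As_mono); rewrite (ltnW lt_q).
apply: (bound (2 * m + 1)%N l (10 * m * a)%N (fun q => As (q%:Z - m%:Z))) => //.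
- move=> u hu.
  have sz : (size u < (2 * m + 1) * l.+1)%N.
    by apply: leq_ltn_trans hu _; rewrite mulnC ltn_ceil.
  exact: (sparse_cut (cuts := fun q => As (q%:Z - m%:Z)) disj sz).
- by move=> q hq; apply: (cuts_near As0 As_mono).
- exact: leq_div.
- by lia.
(* 40 m a <= 20 b m a because b >= 2, and 4 b l <= b m a. *)
nia.
Qed.
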